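(* Let $K \subseteq \mathbb{Z}_{\ge 2}$ and let $d$ be a positive integer. Then there exists $v_0$ such that for every integer $v \ge v_0$ satisfying $$v-1 \equiv 0 \pmod{\alpha(K)} \quad\text{and}\quad v(v-1) \equiv 0 \pmod{\beta(K)},$$ there exists a PBD$(v,K)$ of dimension at least $d$.
   Context: For $K \subseteq \mathbb{Z}_{\ge 2}=\{2,3,4,\dots\}$, a pairwise balanced design PBD$(v,K)$ is a pair $(X,\mathcal{B})$ where $X$ is a set of $v$ points and $\mathcal{B}$ is a collection of subsets of $X$ (blocks) with $|B|\in K$ for all $B\in\mathcal{B}$, such that any two distinct points of $X$ lie together in exactly one block. A subspace of $(X,\mathcal{B})$ is a subset $X'\subseteq X$ such that every block containing two distinct points of $X'$ is contained in $X'$ (in particular each block is a subspace); it is proper if $X'\neq X$. The subspace generated by $Y\subseteq X$ is the intersection of all subspaces containing $Y$. The PBD has dimension at least $d$ if every set of at most $d$ points generates a proper subspace (equivalently, is contained in a proper subspace); its dimension is the largest such $d$. Here $\alpha(K)=\gcd\{k-1 : k\in K\}$ and $\beta(K)=\gcd\{k(k-1): k\in K\}$. *)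

(* Defs.v *)
From mathcomp Require Import all_boot.
Set Implicit Arguments. Unset Strict Implicit. Unset Printing Implicit Defensive.

(* g is the greatest common divisor of the (possibly infinite) set S of
   naturals: a common divisor of all elements, divisible by every common
   divisor (gcd of the empty set is 0). *)
Definition is_setgcd (S : nat -> Prop) (g : nat) : Prop :=
  (forall s, S s -> g %| s) /\
  (forall e, (forall s, S s -> e %| s) -> e %| g).

Definition is_alpha (K : nat -> Prop) (a : nat) : Prop :=
  is_setgcd (fun n => exists2 k, K k & n = k - 1) a.

Definition is_beta (K : nat -> Prop) (b : nat) : Prop :=
  is_setgcd (fun n => exists2 k, K k & n = k * (k - 1)) b.

Definition is_PBD (K : nat -> Prop) (v : nat) (B : {set {set 'I_v}}) : Prop :=
  (forall b, b \in B -> K #|b|) /\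
  (forall x y : 'I_v, x != y ->
     #|[set b in B | (x \in b) && (y \in b)]| = 1).

Definition is_subspace (v : nat) (B : {set {set 'I_v}}) (X' : {set 'I_v}) : bool :=
  [forall b in B, forall x in X', forall y in X',
     ((x != y) && (x \in b) && (y \in b)) ==> (b \subset X')].

Definition gen_subspace (v : nat) (B : {set {set 'I_v}}) (Y : {set 'I_v}) : {set 'I_v} :=
  \bigcap_(S | is_subspace B S && (Y \subset S)) S.

Definition dim_at_least (v : nat) (B : {set {set 'I_v}}) (d : nat) : Prop :=
  forall Y : {set 'I_v}, #|Y| <= d -> gen_subspace B Y != [set: 'I_v].

(* Main.v *)
Require Import Defs.
From mathcomp Require Import all_boot all_order all_algebra all_fingroup all_solvable all_field.
From mathcomp Require Import zify ring lra.
From Stdlib Require Import Classical.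
Set Implicit Arguments. Unset Strict Implicit. Unset Printing Implicit Defensive.
Import Order.TTheory GRing.Theory Num.Theory.

(* Graph decompositions into cliques with sizes in [K] are combined by Wilson's
   fundamental construction. Four sources feed it.

   Cyclotomy: in a field whose order is large and congruent to 1 modulo k(k-1),
   a second moment bound lets one choose a k-set greedily with differences in
   prescribed, pairwise distinct cosets; its translates and multiples form a
   design.

   Signed designs: modulo the lattice spanned by the blocks, an edge xy of a
   complete multipartite graph is a sum D(x) + D(y) + const, so that graph is an
   integral combination of blocks as soon as the divisibility conditions hold.
   Adding all blocks many times makes the coefficients nonnegative, at the price
   of covering every edge l times, for any large l.

   Lifting: for l a prime power, l-fold coverings of the multipartite graph lift
   to exact decompositions of its blow-up by a large extension of the field of
   order l: the l copies through an edge are separated by the trace of a slope.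
   This yields groups of size g l^n for any admissible type g^u.

   Residues: blow-ups by powers of 2 and of 3 allow a group of a transversal
   design to receive any large total weight divisible by alpha, while pbd sizes
   exist in every admissible residue class. Weighting an affine space over a
   field of order 1 modulo beta, with one exceptional point, then reaches all
   large admissible v; flats lift to subspaces, which gives the dimension. *)

(** * Clique decompositions and group divisible designs *)

(** Every large [v] must be hit exactly, although the ingredients exist only for sparse sizes. In
    [v = M * G * (n - 1) + (h - 1) + 1], where [n] counts the points of the affine space, only [M]
    grows with [v]. The size [h] depends on the class of [v] modulo a fixed [W], so it takes
    finitely many values, and a large [M] leaves room to produce [h - 1] as the total weight of one
    group. Writing [h - 1 = al * (a * Q1 + b * Q2)] requires coprime [Q1] and [Q2], hence two
    primes: blow-ups by a single one would leave all weights divisible by a high power of it. The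
    field has order [k + 1] with [beta] dividing [k], because truncated transversal designs need
    ingredients with [k] and with [k + 1] groups at once, and both counts [u] then satisfy the
    sufficient condition that [beta] divides [u * (u - 1)]. The possibly infinite [K] enters only
    through a finite list of block sizes that yields the same two gcds. *)

Definition decomp (K : nat -> Prop) (V : finType) (r : rel V)
    (B : {set {set V}}) : Prop :=
  [/\ forall b, b \in B -> K #|b|,
      forall b x y, b \in B -> x \in b -> y \in b -> x != y -> r x y,
      forall x y, r x y -> exists2 b, b \in B & (x \in b) && (y \in b)
    & forall b b' x y, b \in B -> b' \in B -> x != y ->
        x \in b -> y \in b -> x \in b' -> y \in b' -> b = b'].

Definition dec K (V : finType) (r : rel V) := exists B, decomp K r B.

Lemma eq_dec K (V : finType) (r r' : rel V) : r =2 r' -> dec K r -> dec K r'.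
Proof.
move=> E [B [h1 h2 h3 h4]]; exists B; split=> //.
- by move=> b x y bB xb yb xy; rewrite -E; apply: h2 bB xb yb xy.
- by move=> x y; rewrite -E; apply: h3.
Qed.

Lemma dec0 K (V : finType) (r : rel V) : (forall x y, r x y = false) -> dec K r.
Proof.
move=> r0; exists set0; split=> [b|b x y|x y|b b' x y]; rewrite ?inE //.
by rewrite r0.
Qed.

Lemma decomp_union K (V J : finType) (r : rel V) (s : J -> rel V) :
    (forall j, dec K (s j)) ->
    (forall j x y, s j x y -> r x y) ->
    (forall x y, r x y -> exists j, s j x y) ->
    (forall i j x y, s i x y -> s j x y -> i = j) ->
  exists2 B, decomp K r B & forall b, b \in B ->
    exists j, forall x y, x \in b -> y \in b -> x != y -> s j x y.
Proof.
move=> /fin_all_exists[Bf Bfd] sr rs su; exists (\bigcup_j Bf j); last first.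
  move=> b /bigcupP[j _ bj]; exists j => x y xb yb xy.
  by case: (Bfd j) => _ h _ _; apply: h bj xb yb xy.
split.
- by move=> b /bigcupP[j _ bj]; case: (Bfd j) => h _ _ _; apply: h.
- move=> b x y /bigcupP[j _ bj] xb yb xy; apply: (sr j).
  by case: (Bfd j) => _ h _ _; apply: h bj xb yb xy.
- move=> x y /rs[j sj]; case: (Bfd j) => _ _ h _; have [b bj bxy] := h _ _ sj.
  by exists b => //; apply/bigcupP; exists j.
- move=> b b' x y /bigcupP[i _ bi] /bigcupP[j _ bj] xy xb yb xb' yb'.
  have Hi : s i x y by case: (Bfd i) => _ h _ _; apply: h bi xb yb xy.
  have Hj : s j x y by case: (Bfd j) => _ h _ _; apply: h bj xb' yb' xy.
  move: bj; rewrite -(su _ _ _ _ Hi Hj) => bj.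
  by case: (Bfd i) => _ _ _ h; apply: h bi bj xy xb yb xb' yb'.
Qed.

Lemma dec_union K (V J : finType) (r : rel V) (s : J -> rel V) :
    (forall j, dec K (s j)) ->
    (forall j x y, s j x y -> r x y) ->
    (forall x y, r x y -> exists j, s j x y) ->
    (forall i j x y, s i x y -> s j x y -> i = j) ->
  dec K r.
Proof.
by move=> h1 h2 h3 h4; have [B BP _] := decomp_union h1 h2 h3 h4; exists B.
Qed.

(** Two distinct points of a block are [r]-related, hence lie in [D]; injectivity on [D] therefore
    preserves block sizes. *)
Lemma dec_image K (V V' : finType) (r : rel V) (r' : rel V') (D : pred V)
    (f : V -> V') :
    {in D &, injective f} ->
    (forall x y, r x y -> D x && D y) ->
    (forall x y, r x y -> r' (f x) (f y)) ->
    (forall x' y', r' x' y' -> exists x y, [/\ x' = f x, y' = f y & r x y]) ->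
  dec K r -> dec K r'.
Proof.
move=> fi rD rr' r'r [B [h1 h2 h3 h4]].
have bi b : b \in B -> {in b &, injective f}.
  move=> bB x y xb yb fxy; apply/eqP/negPn/negP => xy.
  have /andP[Dx Dy] := rD _ _ (h2 _ _ _ bB xb yb xy).
  by move/eqP: xy; apply; apply: fi.
exists [set f @: (b : {set V}) | b in B]; split.
- by move=> b' /imsetP[b bB ->]; rewrite (card_in_imset (bi _ bB)); apply: h1.
- move=> b' x' y' /imsetP[b bB ->] /imsetP[x xb ->] /imsetP[y yb ->] xy.
  by apply: rr'; apply: h2 bB xb yb _; apply: contraNneq xy => ->.
- move=> x' y' /r'r[x [y [-> -> /h3[b bB /andP[xb yb]]]]].
  exists (f @: b); first by apply/imsetP; exists b.
  by apply/andP; split; apply: imset_f.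
- move=> b1' b2' x' y' /imsetP[b1 b1B ->] /imsetP[b2 b2B ->] xy.
  move=> /imsetP[x1 x1b x1E] /imsetP[y1 y1b y1E].
  move=> /imsetP[x2 x2b x2E] /imsetP[y2 y2b y2E].
  have xy1 : x1 != y1 by apply: contraNneq xy => E; rewrite x1E y1E E.
  have xy2 : x2 != y2 by apply: contraNneq xy => E; rewrite x2E y2E E.
  have /andP[Dx1 Dy1] := rD _ _ (h2 _ _ _ b1B x1b y1b xy1).
  have /andP[Dx2 Dy2] := rD _ _ (h2 _ _ _ b2B x2b y2b xy2).
  have Ex : x1 = x2 by apply: fi => //; rewrite -x1E -x2E.
  have Ey : y1 = y2 by apply: fi => //; rewrite -y1E -y2E.
  suff -> : b1 = b2 by [].
  by apply: (h4 _ _ x1 y1) => //; rewrite ?Ex ?Ey.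
Qed.

Section Fibers.
Variables (V W : finType) (pr : V -> W).

Definition fib (w : W) := [set x | pr x == w].

(** The complete multipartite graph on the fibres over [b]. Groups given as fibres of a map may be
    empty, and weighting or merging groups becomes composition of maps. *)
Definition cross (b : {set W}) : rel V :=
  fun x y => [&& pr x \in b, pr y \in b & pr x != pr y].

Lemma cross_nonempty (b b' : {set W}) : b' \subset b ->
  (forall w, w \in b -> w \notin b' -> #|fib w| = 0) -> cross b =2 cross b'.
Proof.
move=> /subsetP sb e0 x y; rewrite /cross.
have E z : (pr z \in b) = (pr z \in b').
  apply/idP/idP; last exact: sb.
  move=> zb; apply/negPn/negP => zb'; have /eqP := e0 _ zb zb'.
  by rewrite cards_eq0 => /eqP/setP/(_ z); rewrite !inE eqxx.
by rewrite !E.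
Qed.
End Fibers.

Lemma dec_cross_transfer K (V V2 W W2 I : finType) (pr : V -> W) (pr2 : V2 -> W2)
    (e : I -> W) (e2 : I -> W2) :
    injective e -> injective e2 ->
    (forall i, #|fib pr (e i)| = #|fib pr2 (e2 i)|) ->
  dec K (cross pr [set e i | i in I]) -> dec K (cross pr2 [set e2 i | i in I]).
Proof.
move=> ei e2i ce.
have [[i0 x20] _|V20] := pickP (fun p : I * V2 => pr2 p.2 == e2 p.1); last first.
  move=> _; apply: dec0 => x y; apply/negP => /and3P[/imsetP[i _ xi] _ _].
  by have := V20 (i, x); rewrite /= xi eqxx.
pose g (i : I) := enum (fib pr (e i)); pose g2 (i : I) := enum (fib pr2 (e2 i)).
have sz i : size (g i) = size (g2 i) by rewrite -!cardE.
pose ix (x : V) := odflt i0 [pick i | e i == pr x].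
have ixE x i : pr x = e i -> ix x = i.
  move=> xi; rewrite /ix; case: pickP => [j /eqP|/(_ i)]; last by rewrite xi eqxx.
  by rewrite xi => /ei.
(* The n-th point of the fibre over [e i] goes to the n-th point of the fibre over [e2 i]. *)
pose f x := nth x20 (g2 (ix x)) (index x (g (ix x))).
have mg x i : (x \in g i) = (pr x == e i) by rewrite mem_enum inE.
have mg2 x i : (x \in g2 i) = (pr2 x == e2 i) by rewrite mem_enum inE.
have pf x i : pr x = e i -> pr2 (f x) = e2 i.
  move=> xi; rewrite /f (ixE _ _ xi); apply/eqP; rewrite -mg2 mem_nth //.
  by rewrite -sz index_mem mg xi.
apply: (dec_image (D := [pred x | pr x \in [set e i | i in I]]) (f := f)).
- move=> x y /imsetP[i _ xi] /imsetP[j _ yj] fxy.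
  have ij : i = j by apply: e2i; rewrite -(pf _ _ xi) -(pf _ _ yj) fxy.
  move: yj fxy; rewrite -ij => yi; rewrite /f (ixE _ _ xi) (ixE _ _ yi).
  move=> /eqP; rewrite nth_uniq -?sz ?index_mem ?mg ?xi ?yi ?enum_uniq //.
  have xg : x \in g i by rewrite mg xi.
  have yg : y \in g i by rewrite mg yi.
  by move=> /eqP E; rewrite -(nth_index x xg) E nth_index.
- by move=> x y /and3P[xb yb _]; rewrite /= xb.
- move=> x y /and3P[/imsetP[i _ xi] /imsetP[j _ yj] xy]; apply/and3P.
  rewrite (pf _ _ xi) (pf _ _ yj) !imset_f //; split=> //.
  by apply: contraNneq xy => /e2i E; rewrite xi yj E.
- have inv x' i : pr2 x' = e2 i -> exists2 x, x' = f x & pr x = e i.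
    move=> xi; have x0 : x' \in g2 i by rewrite mg2 xi.
    have lt : index x' (g2 i) < size (g i) by rewrite sz index_mem.
    have [v0 _] : exists v : V, true by case: (g i) lt => // v; exists v.
    pose x := nth v0 (g i) (index x' (g2 i)).
    have xe : pr x = e i by apply/eqP; rewrite -mg mem_nth.
    exists x => //; rewrite /f (ixE _ _ xe) /x index_uniq ?enum_uniq ?sz ?index_mem //.
    by rewrite nth_index.
  move=> x' y' /and3P[/imsetP[i _ xi] /imsetP[j _ yj] xy].
  have [x xE xe] := inv _ _ xi; have [y yE ye] := inv _ _ yj.
  exists x, y; split=> //; apply/and3P; rewrite xe ye !imset_f //; split=> //.
  by apply: contraNneq xy => /ei E; rewrite xi yj E.
Qed.

Definition gdd_proj u g h (x : 'I_u * 'I_g + 'I_h) : option 'I_u :=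
  match x with inl p => Some p.1 | inr _ => None end.

(** Group type [g^u h^1] in exponential notation; [GDD] below has type [g^u]. *)
Definition GDDh K u g h := dec K (cross (@gdd_proj u g h) setT).

Definition GDD K u g := dec K (cross (fun x : 'I_u * 'I_g => x.1) setT).

Definition pbd K v := GDD K v 1.

(** Blocks have as many points as there are groups, so each block meets every group once. *)
Definition TD u m := GDD (eq u) u m.

Lemma card_fib_some u g h i : #|fib (@gdd_proj u g h) (Some i)| = g.
Proof.
transitivity #|[set (inl (i, a) : 'I_u * 'I_g + 'I_h) | a in 'I_g]|.
  apply: eq_card => x; rewrite inE; apply/idP/imsetP.
    by case: x => [[j a]|//] /= /eqP[->]; exists a.
  by case=> a _ ->.
by rewrite card_imset ?card_ord // => a b [].
Qed.

Lemma card_fib_none u g h : #|fib (@gdd_proj u g h) None| = h.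
Proof.
transitivity #|[set (inr a : 'I_u * 'I_g + 'I_h) | a in 'I_h]|.
  apply: eq_card => x; rewrite inE; apply/idP/imsetP.
    by case: x => [//|a] _; exists a.
  by case=> a _ ->.
by rewrite card_imset ?card_ord // => a b [].
Qed.

Lemma card_fib_fst (I T : finType) (i : I) : #|fib (fun x : I * T => x.1) i| = #|T|.
Proof.
transitivity #|[set (i, a) | a in T]|.
  apply: eq_card => x; rewrite inE; apply/idP/imsetP.
    by case: x => j a /= /eqP->; exists a.
  by case=> a _ ->; rewrite /= eqxx.
by rewrite card_imset // => a b [].
Qed.

Lemma set_param (W : finType) (b : {set W}) u : #|b| = u ->
  exists2 e : 'I_u -> W, injective e & b = [set e i | i in 'I_u].
Proof.
move=> <-; exists enum_val; first exact: enum_val_inj.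
apply/setP => w; apply/idP/imsetP.
  by move=> wb; exists (enum_rank_in wb w) => //; rewrite enum_rankK_in.
by case=> i _ ->; apply: enum_valP.
Qed.

Lemma setT_id (I : finType) : [set i | i in I] = [set: I].
Proof. by apply/setP => i; rewrite inE; apply/imsetP; exists i. Qed.

Lemma GDD_use K u g (V W : finType) (pr : V -> W) (b : {set W}) :
    #|b| = u -> (forall w, w \in b -> #|fib pr w| = g) ->
  GDD K u g -> dec K (cross pr b).
Proof.
move=> /set_param[e ei ->] bg; rewrite /GDD -setT_id.
apply: (dec_cross_transfer (e := id)) => // i.
by rewrite card_fib_fst card_ord bg // imset_f.
Qed.

Lemma GDD_intro K u g (V W : finType) (pr : V -> W) (b : {set W}) :
    #|b| = u -> (forall w, w \in b -> #|fib pr w| = g) ->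
  dec K (cross pr b) -> GDD K u g.
Proof.
move=> /set_param[e ei ->] bg; rewrite /GDD -setT_id.
apply: (dec_cross_transfer (e2 := id)) => // i.
by rewrite card_fib_fst card_ord bg // imset_f.
Qed.

Section Special.
Variables (K : nat -> Prop) (u g h : nat) (V W : finType) (pr : V -> W).
Variables (b : {set W}) (w0 : W).
Hypotheses (w0b : w0 \notin b) (bu : #|b| = u).
Hypotheses (bg : forall w, w \in b -> #|fib pr w| = g) (wh : #|fib pr w0| = h).

Let param : exists e : option 'I_u -> W,
  [/\ injective e, w0 |: b = [set e i | i in {: option 'I_u}]
    & forall i, #|fib (@gdd_proj u g h) i| = #|fib pr (e i)|].
Proof.
have [e ei be] := set_param bu.
have eb i : e i \in b by rewrite be imset_f.
exists (fun o => if o is Some i then e i else w0); split.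
- move=> [i|] [j|] //; first by move/ei->.
  + by move=> E; move: w0b; rewrite -E eb.
  + by move=> E; move: w0b; rewrite E eb.
- apply/setP => w; rewrite in_setU1; apply/idP/imsetP.
    case/orP=> [/eqP->|]; first by exists None.
    by rewrite be => /imsetP[i _ ->]; exists (Some i).
  by case=> -[i|] _ ->; rewrite ?eqxx // eb orbT.
- by case=> [i|]; [rewrite card_fib_some bg | rewrite card_fib_none wh].
Qed.

Lemma GDDh_use : GDDh K u g h -> dec K (cross pr (w0 |: b)).
Proof.
have [e [ei -> ce]] := param; rewrite /GDDh -setT_id.
exact: (dec_cross_transfer (e := id)).
Qed.

Lemma GDDh_intro : dec K (cross pr (w0 |: b)) -> GDDh K u g h.
Proof.
have [e [ei -> ce]] := param; rewrite /GDDh -setT_id.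
exact: (dec_cross_transfer (e2 := id)).
Qed.
End Special.

Lemma setT_option u : [set: option 'I_u] = None |: [set Some i | i in 'I_u].
Proof.
apply/setP => -[i|]; rewrite !inE // imset_f //.
Qed.

Lemma card_somes u : #|[set Some i | i in 'I_u]| = u.
Proof. by rewrite card_imset ?card_ord // => i j []. Qed.

Lemma GDDh0 K u g : GDD K u g -> GDDh K u g 0.
Proof.
move=> H; rewrite /GDDh.
apply: (@eq_dec _ _ (cross (@gdd_proj u g 0) [set Some i | i in 'I_u])).
  move=> x y; rewrite (@cross_nonempty _ _ _ setT [set Some i | i in 'I_u]) //.
  by move=> [i|] _; rewrite ?imset_f // card_fib_none.
apply: GDD_use H; first exact: card_somes.
by move=> w /imsetP[i _ ->]; rewrite card_fib_some.
Qed.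

Lemma GDDhg K u g : GDD K u.+1 g -> GDDh K u g g.
Proof.
move=> H; rewrite /GDDh; apply: GDD_use H.
  by rewrite cardsT card_option card_ord.
by move=> [i|] _; rewrite ?card_fib_some ?card_fib_none.
Qed.

Lemma GDDhgV K u g : GDDh K u g g -> GDD K u.+1 g.
Proof.
apply: GDD_intro; first by rewrite cardsT card_option card_ord.
by move=> [i|] _; rewrite ?card_fib_some ?card_fib_none.
Qed.

(** Wilson's fundamental construction in general form: an edge of the weighted graph lies over
    exactly one block of [L], hence belongs to exactly one ingredient. *)
Lemma dec_weight K K0 (V W : finType) (pr : V -> W) (rW : rel W) L :
    decomp K0 rW L -> (forall x, rW x x = false) ->
    (forall b, b \in L -> dec K (cross pr b)) ->
  dec K (fun x y => rW (pr x) (pr y)).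
Proof.
move=> [_ h2 h3 h4] irr ing.
apply: (@dec_union K V _ _ (fun l x y => (l \in L) && cross pr l x y)).
- move=> l; case: (boolP (l \in L)) => [/ing|_]; first exact: eq_dec.
  exact: dec0.
- by move=> l x y /andP[lL /and3P[xl yl xy]]; apply: h2 lL xl yl xy.
- move=> x y rxy; have [l lL /andP[xl yl]] := h3 _ _ rxy.
  exists l; rewrite lL /= /cross xl yl; apply: contraTneq rxy => ->.
  by rewrite irr.
- move=> l l' x y /andP[lL /and3P[xl yl xy]] /andP[lL' /and3P[xl' yl' _]].
  exact: h4 lL lL' xy xl yl xl' yl'.
Qed.

Lemma card_fib_tag (W : finType) (wt : W -> nat) (w : W) :
  #|fib (fun x : {w : W & 'I_(wt w)} => tag x) w| = wt w.
Proof.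
transitivity #|[set Tagged (fun w => 'I_(wt w)) a | a in 'I_(wt w)]|.
  apply: eq_card => -[w' a]; rewrite inE /=; apply/idP/imsetP.
    by move=> /eqP E; move: a; rewrite E => a; exists a.
  by case=> a' _ /(congr1 tag) /= ->.
by rewrite card_imset ?card_ord // => a b /eqP; rewrite eq_Tagged => /eqP.
Qed.

Lemma card_fib_comp (V W I : finType) (pr : V -> W) (c : W -> I) (i : I) :
  #|fib (fun x => c (pr x)) i| = \sum_(w | c w == i) #|fib pr w|.
Proof.
rewrite -sum1_card.
rewrite (partition_big pr (fun w => c w == i)) /=; last by move=> x; rewrite inE.
apply: eq_bigr => w /eqP wi; rewrite -sum1_card; apply: eq_bigl => x.
by rewrite !inE; case: (eqVneq (pr x) w) => [->|_]; rewrite ?wi ?eqxx ?andbF.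
Qed.

Lemma dec_fill K (V T : finType) (r : rel V) (c : V -> T) :
    (forall x y, c x != c y -> r x y) ->
    dec K (fun x y => c x != c y) ->
    (forall t, dec K (fun x y => [&& c x == t, c y == t & r x y])) ->
  dec K r.
Proof.
move=> cr d0 dt.
pose s (o : option T) x y :=
  if o is Some t then [&& c x == t, c y == t & r x y] else c x != c y.
apply: (@dec_union K V _ r s).
- by case=> [t|] //; apply: dt.
- by case=> [t|] x y /=; [case/and3P | apply: cr].
- move=> x y rxy; case: (eqVneq (c x) (c y)) => xy; last by exists None.
  by exists (Some (c x)); rewrite /= -xy eqxx.
- case=> [t|] [t'|] x y //=.
  + by move=> /and3P[/eqP<- _ _] /and3P[/eqP-> _ _].
  + by move=> /and3P[/eqP-> /eqP-> _]; rewrite eqxx.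
  + by move=> /negP xy /and3P[/eqP E /eqP E']; case: xy; rewrite E E'.
Qed.

(* Wilson's fundamental construction on a transversal design in which only the
   last group carries variable weights. *)
Lemma GDDh_wilson K k m g (wt : 'I_m -> nat) :
    TD k.+1 m -> (forall a, GDDh K k g (wt a)) ->
  GDDh K k (m * g) (\sum_a wt a).
Proof.
move=> td ing.
pose W := (option 'I_k * 'I_m)%type.
pose w (x : W) := if x.1 is Some _ then g else wt x.2.
pose V := {x : W & 'I_(w x)}.
have [L LD] : dec (eq k.+1) (cross (fun x : W => x.1) setT).
  apply: GDD_use td; first by rewrite cardsT card_option card_ord.
  by move=> o _; rewrite card_fib_fst card_ord.
have sum_fst (o : option 'I_k) : \sum_(x : W | x.1 == o) w x = \sum_(a < m) w (o, a).
  have := pair_big_dep (op := addn) (idx := 0) (pred1 o) (fun _ _ => true)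
    (fun i (j : 'I_m) => w (i, j)).
  rewrite big_pred1_eq => ->.
  by apply: eq_big => [x|[i j] _] //=; rewrite andbT.
apply: (@GDDh_intro _ _ _ _ V _ (fun x => (tag x).1) [set Some i | i in 'I_k] None).
- by apply/imsetP => -[].
- exact: card_somes.
- move=> o /imsetP[i _ ->].
  rewrite (card_fib_comp (fun x : V => tag x) (fun x : W => x.1)).
  under eq_bigr => x _ do rewrite card_fib_tag.
  by rewrite sum_fst /w /= sum_nat_const card_ord.
- rewrite (card_fib_comp (fun x : V => tag x) (fun x : W => x.1)).
  under eq_bigr => x _ do rewrite card_fib_tag.
  by rewrite sum_fst /w /=.
rewrite -setT_option.
apply: (@dec_weight K _ V W (fun x => tag x) _ L LD).
  by move=> x; rewrite /cross eqxx !andbF.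
move=> b bL; have [h1 h2 h3 h4] := LD.
have bk : #|b| = k.+1 by rewrite (h1 _ bL).
have binj : {in b &, injective (fun x : W => x.1)}.
  move=> x y xb yb E; apply/eqP/negPn/negP => xy.
  by have := h2 _ _ _ bL xb yb xy; rewrite /cross E eqxx !andbF.
(* With [k.+1] points in distinct groups, a block meets all groups, so it has a single point in the
   group of variable weights. *)
have bT : [set x.1 | x in b] = setT.
  apply/eqP; rewrite eqEcard subsetT cardsT card_option card_ord.
  by rewrite (card_in_imset binj) bk /=.
have : None \in [set x.1 | x in b] by rewrite bT inE.
case/imsetP=> -[o a] ob /= oE; rewrite -{}oE in ob.
rewrite -(setD1K ob); apply: GDDh_use (ing a).
- by rewrite !inE eqxx.
- by apply/eqP; rewrite -eqSS -bk (cardsD1 (None, a) b) ob.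
- move=> [o' a']; rewrite !inE => /andP[ne ob']; rewrite card_fib_tag /w /=.
  case: o' ne ob' => // ne ob'; case/eqP: ne.
  exact: binj.
- by rewrite card_fib_tag.
Qed.

Lemma GDD_inflate K k m g : TD k.+1 m -> GDD K k.+1 g -> GDD K k.+1 (m * g).
Proof.
move=> td H; apply: GDDhgV.
have := @GDDh_wilson K k m g (fun=> g) td (fun _ => GDDhg H).
by rewrite sum_nat_const card_ord.
Qed.

Lemma TD_mul k m n : TD k.+1 m -> TD k.+1 n -> TD k.+1 (m * n).
Proof. exact: GDD_inflate. Qed.

(** Groups are refined: one of size [N * G] receives a design of type [G^N], and its blocks join
    those between the old groups. *)
Lemma GDD_fill_groups K k G N N' :
    GDDh K k (N * G) (N' * G) -> GDD K N G -> GDD K N' G ->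
  GDD K (k * N + N') G.
Proof.
move=> H dN dN'.
pose n (o : option 'I_k) := if o is Some _ then N else N'.
pose W := {o : option 'I_k & 'I_(n o)}.
pose V := (W * 'I_G)%type.
have cW (o : option 'I_k) : #|[set z : W | tag z == o]| = n o.
  by rewrite -(card_fib_tag n o).
have cV (w : W) : #|fib (fun x : V => x.1) w| = G by rewrite card_fib_fst card_ord.
have cT (o : option 'I_k) : #|fib (fun x : V => tag x.1) o| = n o * G.
  rewrite (card_fib_comp (fun x : V => x.1) (fun z : W => tag z)).
  under eq_bigr => w _ do rewrite cV.
  by rewrite sum_nat_cond_const -cW; congr (_ * _); apply: eq_card => z; rewrite !inE.
apply: (@GDD_intro _ _ _ V W (fun x => x.1) setT) => //.
  rewrite cardsT card_tagged sumnE big_map big_enum /=.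
  transitivity (\sum_(o in None |: [set Some i | i in 'I_k]) n o).
    by rewrite -setT_option; apply: eq_big => o; rewrite ?inE ?card_ord.
  rewrite big_setU1 /=; last by apply/imsetP => -[].
  rewrite big_imset /=; last by move=> i j _ _ [].
  by rewrite sum_nat_const card_ord addnC.
apply: (@dec_fill K V _ _ (fun x => tag x.1)).
- by move=> x y xy; rewrite /cross !inE /=; apply: contraNneq xy => ->.
- apply: (@eq_dec _ _ (cross (fun x : V => tag x.1) (None |: [set Some i | i in 'I_k]))).
    by move=> x y; rewrite -setT_option /cross !inE.
  apply: GDDh_use H.
  + by apply/imsetP => -[].
  + exact: card_somes.
  + by move=> o /imsetP[i _ ->]; rewrite cT.
  + by rewrite cT.
- move=> o.
  apply: (@eq_dec _ _ (cross (fun x : V => x.1) [set z : W | tag z == o])).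
    by move=> x y; rewrite /cross !inE.
  by case: o => [i|]; [apply: GDD_use dN | apply: GDD_use dN']; rewrite ?cW.
Qed.

Lemma pbd_use K v (V : finType) (S : {set V}) : #|S| = v -> pbd K v ->
  dec K (fun x y => [&& x \in S, y \in S & x != y]).
Proof.
move=> Sv d; apply: (GDD_use (pr := id)) Sv _ d => w _.
by rewrite -(cards1 w); apply: eq_card => x; rewrite !inE.
Qed.

Lemma pbd_intro K (V : finType) : dec K (fun x y : V => x != y) -> pbd K #|V|.
Proof.
move=> d; apply: (@GDD_intro _ _ _ V V id setT); first by rewrite cardsT.
  by move=> w _; rewrite -(cards1 w); apply: eq_card => x; rewrite !inE.
by apply: eq_dec d => x y; rewrite /cross !inE.
Qed.

Lemma pbd_mul K n q : GDD K n q -> pbd K q -> pbd K (n * q).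
Proof.
move=> dn dq; pose V := ('I_n * 'I_q)%type.
have -> : n * q = #|{: V}| by rewrite card_prod !card_ord.
apply: pbd_intro; apply: (@dec_fill K V _ _ (fun x => x.1)).
- by move=> x y; apply: contraNneq => ->.
- by apply: eq_dec dn => x y; rewrite /cross !inE.
- move=> i; apply: (@eq_dec _ _ (fun x y : V => [&& x \in fib (fun z : V => z.1) i,
    y \in fib (fun z : V => z.1) i & x != y])).
    by move=> x y; rewrite !inE.
  by apply: pbd_use dq; rewrite card_fib_fst card_ord.
Qed.

(* Every group is filled together with the point at infinity [None]. *)
Lemma decomp_fill_infty K (V T : finType) (pr : V -> option T) :
    #|fib pr None| = 1 ->
    (forall t, pbd K (#|fib pr (Some t)| + 1)) ->
    forall (J : finType) (s : J -> rel V),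
    (forall j, dec K (s j)) ->
    (forall j x y, s j x y -> [&& pr x != None, pr y != None & pr x != pr y]) ->
    (forall x y, [&& pr x != None, pr y != None & pr x != pr y] ->
       exists j, s j x y) ->
    (forall i j x y, s i x y -> s j x y -> i = j) ->
  exists2 B, decomp K (fun x y => x != y) B & forall b, b \in B ->
    (exists t, forall x y, x \in b -> y \in b -> x != y -> pr x \in [:: None; Some t])
    \/ (exists j, forall x y, x \in b -> y \in b -> x != y -> s j x y).
Proof.
move=> /eqP/cards1P[z zP] dt J s sd sc cs su.
have prz x : (pr x == None) = (x == z).
  by move/setP/(_ x): zP; rewrite !inE.
pose S t := [set x | pr x \in [:: None; Some t]].
pose s' (o : T + J) x y := match o with
  | inl t => [&& x \in S t, y \in S t & x != y]
  | inr j => s j x y end.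
case: (@decomp_union K V _ (fun x y => x != y) s').
- case=> [t|j]; last exact: sd.
  apply: pbd_use (dt t).
  rewrite [S t](_ : _ = fib pr (Some t) :|: fib pr None); last first.
    by apply/setP => x; rewrite !inE orbC.
  rewrite cardsU zP cards1 [_ :&: _](_ : _ = set0) ?cards0 ?subn0 //.
  by apply/setP => x; rewrite !inE -prz; case: (pr x) => [t'|] //=; rewrite andbF.
- case=> [t|j] x y /=; first by case/and3P.
  by move=> /sc/and3P[_ _]; apply: contraNneq => ->.
- move=> x y xy; case: (boolP [&& pr x != None, pr y != None & pr x != pr y]).
    by move=> /cs[j sj]; exists (inr j).
  case Ex: (pr x) => [t|]; last first.
    case Ey: (pr y) => [t'|]; last first.
      move/eqP: Ex; move/eqP: Ey; rewrite !prz => /eqP yz /eqP xz.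
      by rewrite xz yz eqxx in xy.
    by exists (inl t'); rewrite /= !inE Ex Ey !eqxx ?orbT xy.
  case Ey: (pr y) => [t'|] /=.
    rewrite negbK => /eqP[tt']; exists (inl t); rewrite /= !inE Ex Ey tt' !eqxx ?orbT.
    by rewrite xy.
  by exists (inl t); rewrite /= !inE Ex Ey !eqxx ?orbT xy.
- case=> [t|j] [t'|j'] x y /=.
  + rewrite !inE => /and3P[xt yt xy] /and3P[xt' yt' _]; congr inl.
    case Ex: (pr x) => [tx|]; first by move: xt xt'; rewrite Ex /= => /eqP[<-] /eqP[<-].
    case Ey: (pr y) => [ty|]; first by move: yt yt'; rewrite Ey /= => /eqP[<-] /eqP[<-].
    move/eqP: Ex; move/eqP: Ey; rewrite !prz => /eqP yz /eqP xz.
    by rewrite xz yz eqxx in xy.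
  + rewrite !inE => /and3P[xt yt xy] /sc/and3P[xn yn]; move: xt yt.
    by rewrite (negbTE xn) (negbTE yn) /= => /eqP-> /eqP->; rewrite eqxx.
  + move=> + /and3P[]; rewrite !inE => /sc/and3P[xn yn] xy xt yt _; move: xt yt xy.
    by rewrite (negbTE xn) (negbTE yn) /= => /eqP-> /eqP->; rewrite eqxx.
  + by move=> sj sj'; congr inr; apply: su sj sj'.
move=> B BD Bs; exists B => // b /Bs[[t|j] H]; [left; exists t|right; exists j] => //.
by move=> x y xb yb xy; have /and3P[] := H _ _ xb yb xy; rewrite inE.
Qed.

Lemma pbd_fill_infty K M G : GDD K M G -> pbd K (G + 1) -> pbd K (M * G + 1).
Proof.
move=> dM dG; pose V := option ('I_M * 'I_G).
have -> : M * G + 1 = #|{: V}| by rewrite card_option card_prod !card_ord addn1.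
pose pr (x : V) := omap (fun z => z.1) x.
have c1 : #|fib pr None| = 1.
  by rewrite -(cards1 (None : V)); apply: eq_card => -[x|]; rewrite !inE.
have cG i : #|fib pr (Some i)| = G.
  transitivity #|[set (Some (i, a) : V) | a in 'I_G]|.
    apply: eq_card => x; rewrite inE; apply/idP/imsetP.
      by case: x => [[j a]|//] /= /eqP[->]; exists a.
    by case=> a _ ->.
  by rewrite card_imset ?card_ord // => a b [].
case: (@decomp_fill_infty K V _ pr c1 _ unit
  (fun _ => cross pr [set Some i | i in 'I_M])).
- by move=> i; rewrite cG.
- move=> _; apply: GDD_use dM; first exact: card_somes.
  by move=> w /imsetP[i _ ->]; rewrite cG.
- by move=> _ x y /and3P[/imsetP[i _ ->] /imsetP[j _ ->] ->].
- move=> x y /and3P[xn yn xy]; exists tt; rewrite /cross xy andbT.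
  by case: (pr x) (pr y) xn yn => [i|//] [j|//] _ _; rewrite !imset_f.
- by move=> [] [].
by move=> B BD _; apply: pbd_intro; exists B.
Qed.

(** * Transversal designs and closure *)

Section TransversalRing.
Local Open Scope ring_scope.

(** Blocks are graphs of the affine functions on the [e i]; two values determine the slope because
    differences of nodes are invertible. *)
Lemma TD_ring (R : finComUnitRingType) (u : nat) (e : 'I_u -> R) :
  (forall i j, i != j -> e i - e j \is a GRing.unit) -> TD u #|R|.
Proof.
move=> eu.
apply: (@GDD_intro _ _ _ _ _ (fun x : 'I_u * R => x.1) setT).
- by rewrite cardsT card_ord.
- by move=> i _; rewrite card_fib_fst.
pose blk (p : R * R) := [set (i, p.1 * e i + p.2) | i in 'I_u].
have blkP p i a : ((i, a) \in blk p) = (a == p.1 * e i + p.2).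
  apply/imsetP/eqP => [[j _ [-> ->]]//|->]; by exists i.
exists [set blk p | p in {: R * R}]; split.
- move=> b /imsetP[p _ ->]; rewrite card_imset ?card_ord // => i j.
  by case.
- move=> b [i a] [j c] /imsetP[p _ ->]; rewrite !blkP => /eqP-> /eqP->.
  by move=> ij; rewrite /cross !inE /=; apply: contraNneq ij => ->.
- move=> [i a] [j c]; rewrite /cross !inE /= => ij.
  pose m := (a - c) / (e i - e j).
  exists (blk (m, a - m * e i)); first by rewrite imset_f.
  rewrite !blkP /=; apply/andP; split; apply/eqP; first by rewrite addrC subrK.
  have E : m * (e i - e j) = a - c by rewrite divrK ?eu.
  by rewrite [RHS](_ : _ = a - m * (e i - e j)); [rewrite E subKr | ring].
- move=> b b' [i a] [j c] /imsetP[[m w] _ ->] /imsetP[[m' w'] _ ->] ij.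
  rewrite !blkP /= => /eqP ai /eqP cj /eqP ai' /eqP cj'.
  have ne : i != j by apply: contraNneq ij => E; rewrite ai cj E.
  have E (n v : R) : a = n * e i + v -> c = n * e j + v -> n * (e i - e j) = a - c.
    by move=> -> ->; rewrite mulrBr opprD addrACA subrr addr0.
  have mm : m = m'.
    by apply: (mulIr (eu _ _ ne)); rewrite (E _ _ ai cj) (E _ _ ai' cj').
  by subst m'; move: ai'; rewrite ai => /addrI->.
Qed.

(** The nodes are 0, ..., u-1: their differences divide [u!] up to sign, hence are units modulo
    [N]. *)
Lemma TD_Zp u N : (1 < N)%N -> coprime N u`! -> TD u N.
Proof.
move=> N1 cN.
have <- : #|{: 'Z_N}| = N by rewrite card_ord Zp_cast.
apply: (@TD_ring _ u (fun i : 'I_u => (i : nat)%:R : 'Z_N)).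
have H (i j : 'I_u) : (j < i)%N -> (i : nat)%:R - (j : nat)%:R \is a @GRing.unit 'Z_N.
  move=> ji; rewrite -natrB ?(ltnW ji) // unitZpE //.
  apply: coprime_dvdr cN; apply: dvdn_fact.
  by rewrite subn_gt0 ji (leq_trans (leq_subr _ _)) // ltnW.
move=> i j; rewrite neq_ltn => /orP[ij|]; last exact: H.
by rewrite -opprB unitrN H.
Qed.

Lemma TD_field (F : finFieldType) u : (u <= #|F|)%N -> TD u #|F|.
Proof.
move=> uF; apply: (@TD_ring F u (fun i => enum_val (widen_ord uF i))) => i j ij.
rewrite unitfE subr_eq0; apply: contraNneq ij => /enum_val_inj /(congr1 val) /= E.
by apply/eqP/val_inj.
Qed.

End TransversalRing.

Lemma TD1 u : TD u 1.
Proof.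
apply: (@GDD_intro _ _ _ 'I_u _ id setT); first by rewrite cardsT card_ord.
  by move=> w _; rewrite -(cards1 w); apply: eq_card => x; rewrite !inE.
exists [set setT]; split.
- by move=> b /set1P->; rewrite cardsT card_ord.
- by move=> b x y /set1P-> _ _ xy; rewrite /cross !inE.
- by move=> x y _; exists setT; rewrite !inE.
- by move=> b b' x y /set1P-> /set1P->.
Qed.

(* Each prime power factor of [b ^ e] is at least [2 ^ e > k]. *)
Lemma TD_exp k b e : 0 < b -> k.+1 <= e -> TD k.+1 (b ^ e).
Proof.
elim/ltn_ind: b => b IH b0 ke.
case: (ltngtP b 1) => [|b1|->]; [lia | | by rewrite exp1n; apply: TD1].
have pp := pdiv_prime b1; have pd := pdiv_dvd b.
rewrite -(divnK pd) expnMn; apply: TD_mul.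
  apply: IH => //; last by rewrite divn_gt0 ?prime_gt0 // dvdn_leq.
  by rewrite ltn_Pdiv ?prime_gt1.
have [F _ cF] := PrimePowerField pp (leq_trans (ltn0Sn k) ke).
rewrite -cF; apply: TD_field; rewrite cF (leq_trans ke) // ltnW //.
exact/ltn_expl/prime_gt1.
Qed.

(** In the last group, [N'] points get weight [G] and the others weight 0. Blocks through the latter
    need only the ingredient with [k] groups. *)
Lemma GDDh_truncate K k N N' G :
    TD k.+1 N -> GDD K k G -> GDD K k.+1 G -> N' <= N ->
  GDDh K k (N * G) (N' * G).
Proof.
move=> td dk dk1 NN.
have -> : N' * G = \sum_(a < N) (if a < N' then G else 0).
  by rewrite -big_mkcond /= (big_ord_narrow NN) sum_nat_const card_ord.
apply: GDDh_wilson => // a.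
by case: ifP => _; [apply: GDDhg | apply: GDDh0].
Qed.

(** [j] and [y] are the quotient and remainder of [u - (2 * k + 1)] by [k * Z]. The bound on [u]
    gives [j >= 2 * k + 1], which keeps the remainder part [k.+1 + y] below [1 + Z * j]. *)
Lemma truncation_arith k Z u : 0 < k -> 0 < Z ->
    k.+1 + k + k * Z * (k + k.+1) < u ->
  exists j y, [/\ u = k * (1 + Z * j) + (k.+1 + y), k.+1 + y <= 1 + Z * j
                & 1 + Z * j < u].
Proof.
move=> k0 Z0 uU; have kZ0 : 0 < k * Z by rewrite muln_gt0 k0.
exists ((u - (k.+1 + k)) %/ (k * Z)), ((u - (k.+1 + k)) %% (k * Z)).
set x := u - (k.+1 + k).
have xu : u = x + (k.+1 + k).
  by rewrite subnK // ltnW // (leq_ltn_trans _ uU) ?leq_addr.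
have jl : k + k.+1 <= x %/ (k * Z).
  rewrite leq_divRL // mulnC -(leq_add2l (k.+1 + k)); apply: ltnW.
  by rewrite [in X in _ < X]addnC -xu.
have xE := divn_eq x (k * Z); have yl : x %% (k * Z) < k * Z by rewrite ltn_mod.
move: (x %/ (k * Z)) (x %% (k * Z)) xE yl jl => j y xE yl jl.
have uE : u = k * (1 + Z * j) + (k.+1 + y).
  by rewrite xu xE mulnDr muln1 (mulnC j) mulnA; clear; lia.
have Zj : Z * (k + k.+1) <= Z * j by rewrite leq_mul2l jl orbT.
have kkZ : k <= k * Z by rewrite leq_pmulr.
split=> //; first by move: Zj yl kkZ; rewrite mulnDr mulnS (mulnC Z k); clear; lia.
rewrite uE addnS ltnS addnA (leq_trans _ (leq_addr _ _)) //.
by rewrite (leq_trans _ (leq_addr _ _)) // leq_pmull.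
Qed.

(** Induction through [u = k * N + N']: a transversal design is truncated and its groups are
    refined. The factorial in the modulus of [N] provides that design; as [beta] divides [k], the
    number [N'] is again 1 modulo [beta]. Only finitely many [u] remain as starting values. *)
Lemma GDD_all K G k beta :
    0 < k -> 0 < beta -> beta %| k -> GDD K k G ->
    (forall u, k < u <= k.+1 + k + k * (k.+1`! * beta) * (k + k.+1) ->
       u = 1 %[mod beta] -> GDD K u G) ->
  forall u, k < u -> u = 1 %[mod beta] -> GDD K u G.
Proof.
move=> k0 b0 bk dk dU; elim/ltn_ind=> u IH ku u1.
case: (leqP u (k.+1 + k + k * (k.+1`! * beta) * (k + k.+1))) => uU.
  by apply: dU => //; rewrite ku.
have [||j [y [uE NN Nu]]] := truncation_arith _ _ uU => //.
  by rewrite muln_gt0 fact_gt0.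
set N := 1 + _ in uE NN Nu; set N' := k.+1 + _ in uE NN.
have kN' : k < N' by rewrite leq_addr.
have kN : k < N := leq_trans kN' NN.
have N1 : N = 1 %[mod beta] by rewrite /N mulnAC addnC modnMDl.
have N'1 : N' = 1 %[mod beta].
  by rewrite -u1 uE; have /dvdnP[q ->] := bk; rewrite mulnAC modnMDl.
rewrite uE; apply: GDD_fill_groups.
- apply: GDDh_truncate => //.
    apply: TD_Zp; first exact: leq_ltn_trans kN.
    by rewrite /N -mulnA coprime_sym /coprime addnC mulnC gcdnMDl gcdn1.
  apply: dU; last by have /dvdnP[q ->] := bk; rewrite -addn1 modnMDl.
  by rewrite leqnn /= -addnA leq_addr.
- exact: IH.
- by apply: IH => //; apply: leq_ltn_trans Nu.
Qed.

(** * Cyclotomic designs *)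

Section Cyclotomy.
Local Open Scope ring_scope.
Variables (F : finFieldType) (m h : nat) (w : F).
Hypotheses (m0 : (0 < m)%N) (h0 : (0 < h)%N) (qE : #|F| = (m * h).+1).
Hypothesis (wP : m.-primitive_root w).

Lemma expf_card_pred (x : F) : x != 0 -> x ^+ (m * h) = 1.
Proof.
by move=> x0; apply: (mulfI x0); rewrite mulr1 -exprS -qE expf_card.
Qed.

Lemma colorP (x : F) : x != 0 -> exists2 i, (i < m)%N & x ^+ h = w ^+ i.
Proof.
move=> x0; have /(prim_rootP wP)[i ->] : (x ^+ h) ^+ m = 1.
  by rewrite -exprM mulnC expf_card_pred.
by exists i.
Qed.

Lemma color_inj i j : (i < m)%N -> (j < m)%N -> w ^+ i = w ^+ j -> i = j.
Proof.
by move=> im jm /eqP; rewrite (eq_prim_root_expr wP) !modn_small // => /eqP.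
Qed.

Variable A : {set F}.

(** The colour of a nonzero [y] is the [i < m] with [y ^+ h = w ^+ i]; it names the coset of [y]
    modulo the [h]-th roots of unity. *)
Definition hit (x a : F) (i : nat) : bool := (a != x) && ((x - a) ^+ h == w ^+ i).

Definition deg (x : F) (i : nat) : nat := #|[set a in A | hit x a i]|.

Lemma degE x i : deg x i = (\sum_(a in A) hit x a i)%N.
Proof.
rewrite /deg -sum1_card.
rewrite (eq_bigl (fun a => (a \in A) && hit x a i)); last by move=> a; rewrite inE.
by rewrite big_mkcondr; apply: eq_bigr => a _; case: (hit x a i).
Qed.

Lemma sum_hit x a : (\sum_(i < m) hit x a i)%N = (a != x).
Proof.
case: (eqVneq a x) => ax /=.
  by rewrite big1 // => i _; rewrite /hit ax eqxx.
have [|i im iE] := @colorP (x - a); first by rewrite subr_eq0 eq_sym.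
rewrite (bigD1 (Ordinal im)) //= /hit ax iE eqxx big1 // => j ij.
case: eqP => //= E; case/eqP: ij; apply/val_inj => /=.
by rewrite (@color_inj i j).
Qed.

Lemma sum_hit2 x a b : (\sum_(i < m) hit x a i * hit x b i)%N =
  [&& a != x, b != x & (x - a) ^+ h == (x - b) ^+ h].
Proof.
case: (eqVneq a x) => ax /=.
  by rewrite big1 // => i _; rewrite /hit ax eqxx.
have [|i im iE] := @colorP (x - a); first by rewrite subr_eq0 eq_sym.
rewrite (bigD1 (Ordinal im)) //= big1 /hit ?ax ?iE ?eqxx ?mul1n ?addn0 //=.
  by rewrite [w ^+ i == _]eq_sym.
move=> j ij; case: eqP => //= E; case/eqP: ij; apply/val_inj => /=.
by rewrite (@color_inj i j).
Qed.

Lemma sum_deg : (\sum_(x : F) \sum_(i < m) deg x i + #|A| = #|F| * #|A|)%N.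
Proof.
under eq_bigr => x _.
  under eq_bigr => i _ do rewrite degE.
  rewrite exchange_big /=; under eq_bigr => a _ do rewrite sum_hit.
  over.
rewrite exchange_big /= -{1}sum1_card -big_split /= [RHS]mulnC -sum_nat_const.
apply: eq_bigr => a _.
rewrite addn1 [#|F|](cardD1 a) inE add1n; congr _.+1.
rewrite -sum1_card [RHS]big_mkcond /=; apply: eq_bigr => x _.
by rewrite !inE eq_sym; case: (x == a).
Qed.

(** The map sending [x] to [(x - a) / (x - b)] is injective, and equal colours force its value to be
    an [h]-th root of unity other than 1. *)
Lemma card_ratio (a b : F) : a != b ->
  (#|[set x | [&& a != x, b != x & (x - a) ^+ h == (x - b) ^+ h]]| <= h.-1)%N.
Proof.
move=> ab; set S := [set x | _].
pose f x := (x - a) / (x - b).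
have SP x : x \in S -> [/\ x - a != 0, x - b != 0 & (x - a) ^+ h = (x - b) ^+ h].
  by rewrite inE => /and3P[xa xb /eqP]; split; rewrite // subr_eq0 eq_sym.
have fi : {in S &, injective f}.
  move=> x y /SP[xa xb _] /SP[ya yb _] /eqP.
  rewrite /f (can2_eq (divfK xb) (mulfK xb)) mulrAC -(can2_eq (mulfK yb) (divfK yb)) => /eqP E.
  apply: (@mulIf _ (a - b)); first by rewrite subr_eq0.
  have : (x - a) * (y - b) - (y - a) * (x - b) = 0 by rewrite E subrr.
  by move=> E0; apply/eqP; rewrite -subr_eq0 -E0; apply/eqP; ring.
rewrite -(card_in_imset fi).
pose R := [set y : F | y ^+ h == 1].
have cR : (#|R| <= h)%N.
  rewrite cardE; apply: (max_unity_roots h0); last exact: enum_uniq.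
  by apply/allP => y; rewrite mem_enum inE unity_rootE.
have sub : f @: S \subset R :\ 1.
  apply/subsetP => y /imsetP[x /SP[xa xb E] ->]; rewrite !inE /f; apply/andP; split.
    apply: contraNneq ab => /(congr1 (fun z => z * (x - b))).
    by rewrite divfK // mul1r => /addrI/oppr_inj->.
  by rewrite expr_div_n E divff // expf_neq0.
apply: leq_trans (subset_leq_card sub) _.
by move: cR; rewrite (cardsD1 1 R) inE expr1n eqxx add1n; case: h h0.
Qed.

(** Expanding the square counts pairs [a], [b] in [A] seen from [x] in the same colour: [m * h]
    points [x] when [a = b], at most [h.-1] otherwise. *)
Lemma sum_deg2 : (\sum_(x : F) \sum_(i < m) deg x i ^ 2 <=
  #|A| * (m * h) + #|A| * (#|A| * h.-1 - h.-1))%N.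
Proof.
have -> : (\sum_(x : F) \sum_(i < m) deg x i ^ 2 =
  \sum_(a in A) \sum_(b in A)
    #|[set x | [&& a != x, b != x & (x - a) ^+ h == (x - b) ^+ h]]|)%N.
  transitivity (\sum_(x : F) \sum_(a in A) \sum_(b in A)
      [&& a != x, b != x & (x - a) ^+ h == (x - b) ^+ h])%N.
    apply: eq_bigr => x _.
    transitivity (\sum_(i < m) \sum_(a in A) \sum_(b in A) hit x a i * hit x b i)%N.
      by apply: eq_bigr => i _; rewrite -mulnn degE big_distrlr.
    rewrite exchange_big /=; apply: eq_bigr => a _.
    by rewrite exchange_big /=; apply: eq_bigr => b _; rewrite sum_hit2.
  rewrite exchange_big /=; apply: eq_bigr => a _.
  rewrite exchange_big /=; apply: eq_bigr => b _.
  rewrite -sum1_card [RHS]big_mkcond /=; apply: eq_bigr => x _.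
  by rewrite inE; case: [&& _, _ & _].
rewrite -mulnDr -sum_nat_const; apply: leq_sum => a aA.
rewrite (bigD1 a) //=; apply: leq_add.
  rewrite -ltnS -qE -[X in (_ < X)%N]cardsT; apply: proper_card.
  by apply/properP; split; [exact: subsetT | exists a; rewrite ?inE // eqxx].
apply: leq_trans (_ : \sum_(b in A | b != a) h.-1 <= _)%N.
  by apply: leq_sum => b /andP[_ ba]; apply: card_ratio; rewrite eq_sym.
rewrite sum_nat_cond_const (cardsD1 a A) aA mulnDl mul1n addKn leq_mul2r.
by apply/orP; right; rewrite subset_leq_card //; apply/subsetP => b; rewrite !inE andbC.
Qed.

(** The last hypothesis says that the sum of [(2 * m * deg - 2 * a) ^ 2] over points and colours is
    at least [X * a ^ 2], with the cross term moved to the left to stay in [nat]. A point with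
    [2 * m * deg < a] contributes at least [a ^ 2]. *)
Lemma bad_arith a a' h' q X S1 S2 : a = a'.+1 -> h = h'.+1 -> q = (m * h).+1 ->
    (S1 + a = q * a -> S2 <= a * (m * h) + a * (a * h' - h') ->
    8 * m * a * S1 + X * a ^ 2 <= 4 * m ^ 2 * S2 + 4 * m * q * a ^ 2 ->
  X * a <= 4 * m ^ 2 * q)%N.
Proof.
move=> aE hE qE' S1E S2E H.
have {}S1E : S1 = (m * h * a)%N by apply: (@addIn a); rewrite S1E qE' mulSnr.
have {}S2E : (S2 <= a * (m * h) + a * (a' * h'))%N.
  by apply: leq_trans S2E _; rewrite aE mulSn addKn.
have {S2E} S2E : (4 * m ^ 2 * S2 <= 4 * m ^ 2 * (a * (m * h) + a * (a' * h')))%N.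
  by rewrite leq_mul2l S2E orbT.
have ma : (m * a ^ 2 <= m ^ 2 * a ^ 2)%N.
  by rewrite leq_mul2r -[(m ^ 2)%N]mulnn leq_pmulr ?orbT.
suff : (X * a * a <= 4 * m ^ 2 * q * a)%N by rewrite leq_pmul2r ?aE.
move: H S2E ma; rewrite S1E qE' hE aE !expnS !expn0; clear; lia.
Qed.

(* Chebyshev's inequality for the number of neighbours in [A] of a given colour. *)
Lemma card_bad (i0 : nat) : (i0 < m)%N ->
  (#|[set x | 2 * m * deg x i0 < #|A| ]| * #|A| <= 4 * m ^ 2 * #|F|)%N.
Proof.
move=> im; set X := [set x | _].
case aE: #|A| => [|a']; first by rewrite muln0.
rewrite -{1}aE; move/esym: (esym aE) => {}aE.
apply: (bad_arith aE (esym (prednK h0)) qE sum_deg sum_deg2).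
have -> : (#|X| * #|A| ^ 2 =
  \sum_(x : F) \sum_(i < m) ((x \in X) && (i == i0 :> nat)) * #|A| ^ 2)%N.
  rewrite -sum_nat_const big_mkcond /=; apply: eq_bigr => x _.
  rewrite (bigD1 (Ordinal im)) //= big1 => [|i]; last first.
    by rewrite -val_eqE /= => /negbTE->; rewrite andbF.
  by rewrite eqxx andbT addn0; case: (x \in X); rewrite ?mul1n.
have -> : (4 * m * #|F| * #|A| ^ 2 = \sum_(x : F) \sum_(i < m) 4 * #|A| ^ 2)%N.
  transitivity (#|F| * (m * (4 * #|A| ^ 2)))%N.
    by move: #|F| (#|A| ^ 2)%N; clear; lia.
  by rewrite !sum_nat_const card_ord; congr (_ * _)%N; apply: eq_card.
rewrite !big_distrr /= -!big_split /=; apply: leq_sum => x _.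
rewrite !big_distrr /= -!big_split /=; apply: leq_sum => i _.
case: (boolP ((x \in X) && (i == i0 :> nat))) => [/andP[]|_].
  rewrite inE => + /eqP ii; rewrite -ii; move: #|A| (deg x i) => a d.
  rewrite !expnS !expn0 mul1n => H.
  have [e ->] : exists e, a = (2 * (m * d) + e)%N.
    by exists (a - 2 * (m * d))%N; rewrite subnKC // mulnA ltnW.
  by clear; nia.
move: #|A| (deg x i) => a d; have [+ _] := nat_Cauchy (m * d) a; rewrite mul0n.
by rewrite !expnS !expn0; clear; lia.
Qed.
End Cyclotomy.

(** * Greedy choice of points with prescribed colours of differences *)

Section Greedy.
Local Open Scope ring_scope.
Variables (F : finFieldType) (m h : nat) (w : F).
Hypotheses (m0 : (0 < m)%N) (h0 : (0 < h)%N) (qE : #|F| = (m * h).+1).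
Hypothesis (wP : m.-primitive_root w).

(** Field size sufficient to choose [n] points from sets of density at least [1 / D]. The [n'] later
    sets exclude at most [4 * m ^ 2 * D] points each, while the first set has at least [q / D]; one
    choice divides the densities by at most [2 * m]. *)
Fixpoint threshold (m n D : nat) : nat :=
  if n is n'.+1 then (maxn (4 * n' * m ^ 2 * D * D).+1 (threshold m n' (2 * m * D)))%N
  else 0%N.

(** The first point is chosen so that every later set keeps at least a fraction [1 / (2 * m)] of
    points in the required colour; the recursion continues in these smaller sets. *)
Lemma greedy n D (A : nat -> {set F}) (s : nat -> nat -> nat) :
    (forall i j, s i j < m)%N -> (threshold m n D <= #|F|)%N ->
    (forall i, i < n -> #|F| <= D * #|A i|)%N ->
  exists2 a : nat -> F, (forall i, i < n -> a i \in A i)%N &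
    (forall i j, i < j < n -> a i != a j /\ (a i - a j) ^+ h = w ^+ s i j)%N.
Proof.
elim: n D A s => [|n IH] D A s sm; first by exists (fun=> 0) => // i j; rewrite andbF.
rewrite /= geq_max => /andP[q1 q2] AD.
pose bad i := [set x | 2 * m * deg h w (A i.+1) x (s 0%N i.+1) < #|A i.+1| ]%N.
have badle (i : 'I_n) : (#|bad i| <= 4 * m ^ 2 * D)%N.
  have Ai : (#|F| <= D * #|A i.+1|)%N by apply: AD; rewrite ltnS.
  have A0 : (0 < #|A i.+1|)%N.
    by rewrite lt0n; apply: contraTneq Ai => ->; rewrite muln0 qE.
  rewrite -(leq_pmul2r A0); apply: leq_trans (card_bad m0 h0 qE wP _ (sm _ _)) _.
  by rewrite -[X in (_ <= X)%N]mulnA leq_mul2l Ai orbT.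
pose U := \bigcup_(i < n) bad i.
have cU : (#|U| <= n * (4 * m ^ 2 * D))%N.
  rewrite -[n in (n * _)%N]card_ord -sum_nat_const.
  apply: leq_trans (_ : \sum_(i < n) #|bad i| <= _)%N; last exact: leq_sum.
  rewrite /U; elim/big_ind2: _ => [|b x b' y H H'|//]; first by rewrite cards0.
  by apply: leq_trans (leq_card_setU _ _) _; apply: leq_add.
have [x xA xU] : exists2 x, x \in A 0%N & x \notin U.
  apply/subsetPn; apply: contraL q1 => /subset_leq_card AU.
  rewrite -leqNgt; apply: leq_trans (AD 0%N (ltn0Sn _)) _.
  rewrite mulnC; have := leq_trans AU cU; rewrite -(@leq_pmul2r D).
    by move=> H; apply: leq_trans H _; clear; lia.
  by rewrite lt0n; apply: contraTneq (AD 0%N (ltn0Sn _)) => ->; rewrite mul0n qE.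
pose A' i := [set y in A i.+1 | hit h w x y (s 0%N i.+1)].
have [||i i_n|a aA aC] := IH (2 * m * D)%N A' (fun i j => s i.+1 j.+1) => //.
  have : x \notin bad i.
    by apply: contra xU => xb; apply/bigcupP; exists (Ordinal i_n).
  rewrite inE -leqNgt => Hx; apply: leq_trans (AD i.+1 _) _ => //.
  by rewrite mulnC [X in (_ <= X)%N]mulnAC leq_mul2r; apply/orP; right.
exists (fun i => if i is i'.+1 then a i' else x).
  by case=> [|i] //; rewrite ltnS => /aA; rewrite inE => /andP[].
case=> [|i] [|j] //=; rewrite !ltnS; last exact: aC.
by move=> /aA; rewrite inE => /andP[_ /andP[ne /eqP ->]]; rewrite eq_sym ne.
Qed.

Definition pair_list (k : nat) : seq (nat * nat) :=
  [seq (i, j) | j <- iota 0 k, i <- iota 0 j].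

Lemma mem_pair_list k i j : ((i, j) \in pair_list k) = (i < j < k)%N.
Proof.
apply/allpairsPdep/andP => [[j' [i' [+ + [-> ->]]]]|[ij jk]].
  by rewrite !mem_iota.
by exists j, i; rewrite !mem_iota.
Qed.

Lemma uniq_pair_list k : uniq (pair_list k).
Proof.
apply: allpairs_uniq_dep; first exact: iota_uniq.
  by move=> j _; apply: iota_uniq.
by move=> [j i] [j' i'] _ _ /= [-> ->].
Qed.

Lemma size_pair_list k : (2 * size (pair_list k) = k * k.-1)%N.
Proof.
rewrite size_allpairs_dep; under eq_map => j do rewrite size_iota.
rewrite map_id sumnE -[k in iota 0 k]subn0 -/(index_iota 0 k) bin2_sum.
rewrite mul2n bin2 halfK; case: k => [|n] //=.
by rewrite oddM /= andNb subn0.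
Qed.
End Greedy.

(** * Difference families from cosets of roots of unity *)

Section DifferenceFamily.
Local Open Scope ring_scope.
Variables (F : finFieldType) (k r : nat).
Hypotheses (k2 : (2 <= k)%N) (r0 : (0 < r)%N) (qE : #|F| = (k * k.-1 * r).+1).
Hypothesis qbig : (threshold (size (pair_list k)) k 1 <= #|F|)%N.

Let m := size (pair_list k).
Let h := (2 * r)%N.

Let qE' : #|F| = (m * h).+1.
Proof. by rewrite qE -size_pair_list /h /m -mulnA mulnCA. Qed.

Let m0 : (0 < m)%N.
Proof. by case: (posnP m) (size_pair_list k) => //; rewrite /m; case: k k2 => [|[]] // ? _ ->. Qed.

Let h0 : (0 < h)%N.
Proof. by rewrite muln_gt0. Qed.

Lemma primitive_root_exists : exists w : F, m.-primitive_root w.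
Proof.
have q0 : (0 < m * h)%N by rewrite muln_gt0 m0.
have sz : size [seq x <- enum F | x != 0] = (m * h)%N.
  apply: succn_inj; rewrite -qE' [RHS](cardD1 (0 : F)) inE add1n; congr _.+1.
  rewrite size_filter -sum1_count big_enum_cond -sum1_card /=.
  by apply: eq_bigl => x; rewrite !inE andbT.
have : has (m * h).-primitive_root [seq x <- enum F | x != 0].
  apply: has_prim_root => //.
  - apply/allP => x; rewrite mem_filter unity_rootE => /andP[x0 _].
    by rewrite (expf_card_pred qE').
  - by rewrite filter_uniq ?enum_uniq.
  - by rewrite sz.
case/hasP=> z _ zP; have := dvdn_prim_root zP (dvdn_mulr h (dvdnn m)).
by exists (z ^+ (m * h %/ m)).
Qed.

(** The differences [a i - a j], [i < j], represent the [m] cosets of the group [H] of [h]-th roots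
    of unity once each. As [h] is even, [H] contains -1, so half of [H] as multipliers, together
    with both signs, covers each nonzero difference exactly once. *)
Lemma pbd_difference_family : pbd (eq k) #|F|.
Proof.
have [w wP] := primitive_root_exists.
(* Each pair gets its own colour; the reduction modulo [m] only keeps [s] in range off the list. *)
pose s i j := (index (i, j) (pair_list k) %% m)%N.
have sE i j : (i < j < k)%N -> s i j = index (i, j) (pair_list k).
  by move=> ij; rewrite /s modn_small // index_mem mem_pair_list.
have [|||a _ aC] := @greedy F m h w m0 h0 qE' wP k 1 (fun=> setT) s.
- by move=> i j; rewrite ltn_pmod.
- exact: qbig.
- by move=> i _; rewrite cardsT mul1n.
have hN (x : F) : (- x) ^+ h = x ^+ h by rewrite /h !exprM sqrrN.
pose S (i j : nat) := if (i < j)%N then (i, j) else (j, i).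
have aS i j : (i < k)%N -> (j < k)%N -> i != j ->
    [/\ S i j \in pair_list k, a i != a j &
        (a i - a j) ^+ h = w ^+ index (S i j) (pair_list k)].
  move=> ik jk; rewrite /S neq_ltn; case: ltnP => [ij _|ij /= ji].
    have ijk : (i < j < k)%N by rewrite ij.
    by have [? E] := aC _ _ ijk; rewrite mem_pair_list ijk -sE.
  have jik : (j < i < k)%N by rewrite ji.
  have [? E] := aC _ _ jik; rewrite mem_pair_list jik -sE // eq_sym; split=> //.
  by rewrite -opprB hN.
have aI i j : (i < k)%N -> (j < k)%N -> a i = a j -> i = j.
  by move=> ik jk E; apply/eqP/negPn/negP => /(aS _ _ ik jk)[_ /eqP].
have SI i j i' j' : S i j = S i' j' -> (i = i' /\ j = j') \/ (i = j' /\ j = i').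
  by rewrite /S; case: ifP => _; case: ifP => _ [-> ->]; auto.
have colE i j i' j' : (i < k)%N -> (j < k)%N -> i != j ->
    (i' < k)%N -> (j' < k)%N -> i' != j' ->
    (a i - a j) ^+ h = (a i' - a j') ^+ h ->
    (i = i' /\ j = j') \/ (i = j' /\ j = i').
  move=> ik jk ij ik' jk' ij'; have [m1 _ ->] := aS _ _ ik jk ij.
  have [m2 _ ->] := aS _ _ ik' jk' ij'.
  move=> /(color_inj wP); rewrite !index_mem => /(_ m1 m2) E; apply: SI.
  by rewrite -[LHS](nth_index (0, 0)%N m1) E nth_index.
pose H := [set y : F | y ^+ h == 1].
(* One element out of each pair [y], [-y] of [H], selected by an arbitrary order. *)
pose T := [set y in H | (enum_rank y < enum_rank (- y))%N].
(* The order of [F] is odd and annihilates 1, so [2 = 0] would give [1 = 0]. *)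
have two : (2%:R : F) != 0.
  have : (#|F|%:R : F) = 0.
    by have := expg_cardG (in_setT (1 : F)); rewrite cardsT FinRing.zmodXgE.
  rewrite qE' /h -natr1 mulnCA natrM => E; apply: contraTneq (oner_neq0 F) => E2.
  by move: E; rewrite E2 mul0r add0r => ->; rewrite eqxx.
have neg (y : F) : y != 0 -> y != - y.
  by move=> y0; rewrite -subr_eq0 opprK -mulr2n -mulr_natr mulf_neq0.
have H0 (y : F) : y \in H -> y != 0.
  by rewrite inE; apply: contraTneq => ->; rewrite expr0n -[h]prednK //= eq_sym oner_eq0.
have TH (y : F) : y \in H -> y \in T \/ - y \in T.
  move=> yH; have := neg _ (H0 _ yH).
  rewrite !inE opprK hN; move: yH; rewrite inE => ->.
  case: (ltngtP (enum_rank y) (enum_rank (- y))) => //; [by left | by right |].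
  by move=> /val_inj/enum_rank_inj <-; rewrite eqxx.
have TN (y : F) : y \in T -> - y \notin T.
  by rewrite !inE opprK => /andP[_ yy]; rewrite negb_and -leqNgt (ltnW yy) orbT.
have T0 (y : F) : y \in T -> y != 0 by rewrite inE => /andP[/H0].
pose blk (p : F * F) := [set p.1 * a (i : 'I_k) + p.2 | i in 'I_k].
apply: pbd_intro; exists [set blk p | p in setX T setT]; split.
- move=> b /imsetP[[y v] /setXP[/= yT _] ->].
  rewrite card_imset ?card_ord //= => i j /addIr/(mulfI (T0 _ yT)) /aI E.
  by apply/val_inj; rewrite /= E.
- by move=> b x y _ _ _.
- move=> x y xy.
  have [|c cm cE] := colorP qE' wP (_ : x - y != 0); first by rewrite subr_eq0.
  have cin : nth (0, 0)%N (pair_list k) c \in pair_list k by rewrite mem_nth.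
  case ijE: (nth (0, 0)%N (pair_list k) c) cin => [i j] cin.
  have ijk : (i < j < k)%N by rewrite -mem_pair_list.
  have /andP[ij jk] := ijk; have ik := ltn_trans ij jk.
  have [aij aE] := aC _ _ ijk.
  have {}aE : (a i - a j) ^+ h = (x - y) ^+ h.
    by rewrite aE cE sE // -ijE index_uniq // uniq_pair_list.
  have aij0 : a i - a j != 0 by rewrite subr_eq0.
  pose e := (x - y) / (a i - a j).
  have eE : e * (a i - a j) = x - y by rewrite divfK.
  have eH : e \in H by rewrite inE expr_div_n aE divff // expf_neq0 // subr_eq0.
  case: (TH _ eH) => eT.
    exists (blk (e, x - e * a i)); first by rewrite imset_f // inE /= eT inE.
    apply/andP; split; apply/imsetP => /=.
      by exists (Ordinal ik) => //=; rewrite addrC subrK.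
    exists (Ordinal jk) => //=; apply/eqP; rewrite -subr_eq0.
    have -> : y - (e * a j + (x - e * a i)) = e * (a i - a j) - (x - y) by ring.
    by rewrite eE subrr.
  exists (blk (- e, x + e * a j)); first by rewrite imset_f // inE /= eT inE.
  apply/andP; split; apply/imsetP => /=.
    by exists (Ordinal jk) => //=; rewrite mulNr addrC addrK.
  exists (Ordinal ik) => //=; apply/eqP; rewrite -subr_eq0.
  have -> : y - (- e * a i + (x + e * a j)) = e * (a i - a j) - (x - y) by ring.
  by rewrite eE subrr.
move=> b b' x y /imsetP[[e v] /setXP[/= eT _] ->] /imsetP[[e' v'] /setXP[/= eT' _] ->] xy.
move=> /imsetP[i _ xi] /imsetP[j _ yj] /imsetP[i' _ xi'] /imsetP[j' _ yj'].
rewrite /= in xi yj xi' yj'.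
have d1 : x - y = e * (a i - a j) by rewrite xi yj; ring.
have d2 : x - y = e' * (a i' - a j') by rewrite xi' yj'; ring.
have ij : (i : nat) != j.
  by apply: contraNneq xy => E; rewrite -subr_eq0 d1 E subrr mulr0.
have ij' : (i' : nat) != j'.
  by apply: contraNneq xy => E; rewrite -subr_eq0 d2 E subrr mulr0.
have TE z : z \in T -> z ^+ h = 1 by rewrite !inE => /andP[/eqP].
have cE : (a i - a j) ^+ h = (a i' - a j') ^+ h.
  rewrite -[LHS]mul1r -(TE _ eT) -exprMn -d1 d2 exprMn (TE _ eT') mul1r //.
have [_ aij _] := aS _ _ (ltn_ord i) (ltn_ord j) ij.
have aij0 : a i - a j != 0 by rewrite subr_eq0.
case: (colE _ _ _ _ (ltn_ord i) (ltn_ord j) ij (ltn_ord i') (ltn_ord j') ij' cE) => -[E1 E2].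
  have ee : e = e' by apply: (mulIf aij0); rewrite -d1 d2 E1 E2.
  by subst e'; move: xi'; rewrite xi E1 => /addrI->.
have ee : e = - e' by apply: (mulIf aij0); rewrite -d1 d2 E1 E2; ring.
by have := TN _ eT'; rewrite -ee eT.
Qed.
End DifferenceFamily.

Lemma pbd_finField k : 2 <= k -> exists q0, forall F : finFieldType,
  q0 <= #|F| -> #|F| = 1 %[mod k * k.-1] -> pbd (eq k) #|F|.
Proof.
move=> k2; exists (maxn 2 (threshold (size (pair_list k)) k 1)) => F.
rewrite geq_max => /andP[F2 Fb] /eqP; rewrite eqn_mod_dvd ?(ltnW F2) //.
case/dvdnP=> r rE.
have qE : #|F| = (k * k.-1 * r).+1.
  by rewrite mulnC -rE subn1 prednK // (ltnW F2).
apply: (pbd_difference_family k2 _ qE) => //.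
by rewrite lt0n; apply: contraTneq F2 => r0; rewrite qE r0 muln0.
Qed.

(** * Signed decompositions of complete multipartite graphs *)

Section SubgroupMem.
Local Open Scope ring_scope.
(** By Bezout the subgroup [P] contains the gcd of [s]; the last hypothesis makes that gcd divide
    [z]. *)
Lemma subgroup_mem (P : int -> Prop) (s : seq nat) (z : nat) :
    P 0 -> (forall a b, P a -> P b -> P (a + b)) -> (forall a n, P a -> P (a * n)) ->
    (forall n, n \in s -> P n%:Z) ->
    (forall e, (forall n, n \in s -> e %| n)%N -> (e %| z)%N) -> P z%:Z.
Proof.
move=> P0 PD PM Ps sz.
have Pg : P (\big[gcdn/0%N]_(n <- s) n)%:Z.
  elim: s Ps {sz} => [|n s IH] Ps; first by rewrite big_nil.
  rewrite big_cons; set d := \big[gcdn/0%N]_(n <- s) n.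
  have Pd : P d%:Z by apply: IH => i si; apply: Ps; rewrite inE si orbT.
  have Pn : P n%:Z by apply: Ps; rewrite mem_head.
  have -> : (gcdn n d)%:Z = gcdz n d by [].
  have [a [b <-]] := Bezoutz n d.
  by apply: PD; rewrite mulrC; apply: PM.
have /dvdnP[q ->] : (\big[gcdn/0]_(n <- s) n %| z)%N.
  apply: sz => n ns; elim: s ns {Ps Pg} => // i s IH; rewrite inE big_cons.
  by case/orP=> [/eqP->|/IH]; [apply: dvdn_gcdl | apply: dvdn_trans (dvdn_gcdr _ _)].
by rewrite mulnC PoszM; apply: PM.
Qed.
End SubgroupMem.

Section Signed.
Local Open Scope ring_scope.
Variables (u g : nat) (ks : seq nat).
Notation V := ('I_u * 'I_g)%type.
Notation vec := {ffun V * V -> int}.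

Definition good (B : {set V}) : bool :=
  (#|B| \in ks) && [forall x in B, forall y in B, (x.1 == y.1) ==> (x == y)].

Definition cr (x y : V) : bool := x.1 != y.1.

Definition ind (x : V) (B : {set V}) : int := (x \in B)%:R.

Definition chi (B : {set V}) : vec := [ffun p => (cr p.1 p.2)%:R * ind p.1 B * ind p.2 B].

Definition span (f : vec) : Prop := exists2 n : {set V} -> int,
  (forall B, ~~ good B -> n B = 0) & f = \sum_B chi B *~ n B.

Lemma span0 : span 0.
Proof.
exists (fun=> 0) => //; by rewrite big1 // => B _; rewrite mulr0z.
Qed.

Lemma spanD f f' : span f -> span f' -> span (f + f').
Proof.
move=> [n n0 ->] [n' n0' ->]; exists (fun B => n B + n' B).
  by move=> B B0; rewrite n0 // n0'.
by rewrite -big_split /=; apply: eq_bigr => B _; rewrite mulrzDr.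
Qed.

Lemma spanZ f z : span f -> span (f *~ z).
Proof.
move=> [n n0 ->]; exists (fun B => n B * z); first by move=> B B0; rewrite n0 // mul0r.
by rewrite mulrz_suml; apply: eq_bigr => B _; rewrite mulrzA.
Qed.

Lemma spanN f : span f -> span (- f).
Proof. by move=> /(spanZ (-1)); rewrite mulrN1z. Qed.

Lemma spanB f f' : span f -> span f' -> span (f - f').
Proof. by move=> Sf /spanN; apply: spanD. Qed.

Lemma span_sum (I : Type) (r : seq I) (P : pred I) (f : I -> vec) :
  (forall i, P i -> span (f i)) -> span (\sum_(i <- r | P i) f i).
Proof. by move=> H; elim/big_ind: _ => //; [apply: span0 | apply: spanD]. Qed.

Lemma span_chi B : good B -> span (chi B).
Proof.
move=> gB; exists (fun B' => (B' == B)%:R).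
  by move=> B' B0; case: eqP => // E; rewrite E gB in B0.
rewrite (bigD1 B) //= eqxx mulr1z big1 ?addr0 // => B' /negbTE ->.
by rewrite mulr0z.
Qed.

Definition edge (x y : V) : vec := [ffun p => (p == (x, y))%:R + (p == (y, x))%:R].

Lemma edgeC x y : edge x y = edge y x.
Proof. by apply/ffunP => p; rewrite !ffunE addrC. Qed.

Hypotheses (g0 : (0 < g)%N) (kg : forall k, k \in ks -> (2 <= k)%N /\ (k + 2 <= u)%N).

Lemma rainbow_avoiding (C : {set 'I_u}) n : (n + #|C| <= u)%N ->
  exists A : {set V}, [/\ #|A| = n, {in A &, injective (fun x => x.1)}
    & forall x, x \in A -> x.1 \notin C].
Proof.
move=> nC; have : (n <= #|~: C|)%N.
  rewrite cardsCs setCK card_ord leq_subRL 1?addnC //.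
  by rewrite (leq_trans _ nC) // leq_addl.
case/card_geqP=> s [us ss sC].
exists [set (i, Ordinal g0) | i in [set i in s]]; split.
- rewrite card_imset; last by move=> i j [].
  by rewrite cardsE (card_uniqP us).
- by move=> x y /imsetP[i _ ->] /imsetP[j _ ->] /= ->.
- by move=> x /imsetP[i + ->]; rewrite inE => /sC; rewrite inE.
Qed.

Lemma goodP (B : {set V}) : reflect ((#|B| \in ks) /\ {in B &, injective (fun x : V => x.1)}) (good B).
Proof.
apply: (iffP andP) => -[kB H]; split=> //.
  move=> x y xB yB E; apply/eqP.
  by move/forall_inP/(_ _ xB)/forall_inP/(_ _ yB)/implyP: H; apply; apply/eqP.
apply/forall_inP => x xB; apply/forall_inP => y yB; apply/implyP => /eqP E.
by apply/eqP; apply: H.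
Qed.

Lemma ind_setU1 (z x : V) (A : {set V}) : x \notin A ->
  ind z (x |: A) = (z == x)%:R + ind z A.
Proof.
move=> xA; rewrite /ind in_setU1; case: (eqVneq z x) => [->|] /=.
  by rewrite (negbTE xA) addr0.
by rewrite add0r.
Qed.

Lemma good_setU2 k (a x : V) (A : {set V}) : k \in ks -> (#|A| + 2 = k)%N ->
    {in A &, injective (fun x : V => x.1)} ->
    (forall y, y \in A -> y.1 != a.1) -> (forall y, y \in A -> y.1 != x.1) ->
    a.1 != x.1 ->
  [/\ good (a |: (x |: A)), x \notin A & a \notin x |: A].
Proof.
move=> kk cA iA Aa Ax ax.
have xA : x \notin A by apply/negP => /Ax; rewrite eqxx.
have aA : a \notin x |: A.
  rewrite in_setU1 negb_or; apply/andP; split; first by apply: contraNneq ax => ->.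
  by apply/negP => /Aa; rewrite eqxx.
split=> //; apply/goodP; rewrite !cardsU1 aA xA !add1n -addn2 cA kk; split=> // y z.
rewrite !in_setU1 => /or3P[/eqP->|/eqP->|yA] /or3P[/eqP->|/eqP->|zA] //= E.
- by rewrite E eqxx in ax.
- by have := Aa _ zA; rewrite E eqxx.
- by rewrite E eqxx in ax.
- by have := Ax _ zA; rewrite E eqxx.
- by have := Aa _ yA; rewrite E eqxx.
- by have := Ax _ yA; rewrite E eqxx.
- exact: iA.
Qed.

Hypothesis ks0 : ks != [::].

(* The alternating sum of the four blocks [A + {a or b} + {x or y}]. *)
Lemma span_cycle4 (x a y b : V) : cr x a -> cr a y -> cr y b -> cr b x ->
  span (edge x a - edge a y + edge y b - edge b x).
Proof.
move=> xa ay yb bx; rewrite /cr in xa ay yb bx.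
have [k kk] : exists k, k \in ks by case: ks ks0 => // k s _; exists k; rewrite mem_head.
have [k2 ku] := kg kk.
pose C := [set x.1; a.1; y.1; b.1].
have cC : (#|C| <= 4)%N.
  by do 3!(apply: leq_trans (leq_card_setU _ _) _; rewrite !cards1 addn1 ?ltnS).
(* A common part of [k - 2] points must avoid up to four groups; this is the origin of the bound
   [k + 2 <= u]. *)
have [|A [cA iA AC]] := @rainbow_avoiding C (k - 2)%N.
  by apply: leq_trans ku; rewrite -[X in (_ <= X + _)%N](subnK k2) -addnA leq_add2l.
have Av v : v \in C -> forall z, z \in A -> z.1 != v.
  by move=> vC z zA; apply: contraNneq (AC _ zA) => ->.
have Ax z : z \in A -> z.1 != x.1 by apply: Av; rewrite !inE eqxx.
have Aa z : z \in A -> z.1 != a.1 by apply: Av; rewrite !inE eqxx ?orbT.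
have Ay z : z \in A -> z.1 != y.1 by apply: Av; rewrite !inE eqxx ?orbT.
have Ab z : z \in A -> z.1 != b.1 by apply: Av; rewrite !inE eqxx ?orbT.
have {}cA : (#|A| + 2 = k)%N by rewrite cA subnK.
have G c z := @good_setU2 k c z A kk cA iA.
have [|s1 i1 j1] := G a x Aa Ax; first by rewrite eq_sym.
have [|s2 i2 j2] := G a y Aa Ay; first exact: ay.
have [|s3 i3 j3] := G b y Ab Ay; first by rewrite eq_sym.
have [|s4 i4 j4] := G b x Ab Ax; first exact: bx.
suff -> : edge x a - edge a y + edge y b - edge b x =
    chi (a |: (x |: A)) - chi (a |: (y |: A)) + chi (b |: (y |: A)) - chi (b |: (x |: A)).
  by apply: spanB; [apply: spanD; [apply: spanB|]|]; apply: span_chi.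
apply/ffunP => -[z w]; rewrite !ffunE !xpair_eqE !ind_setU1 //= /cr.
have bM (p q : bool) : (p && q)%:R = p%:R * q%:R :> int by case: p; case: q.
case: (eqVneq z.1 w.1) => zw /=; last by rewrite !bM; ring.
have nE (v v' : V) : v.1 != v'.1 -> (z == v) && (w == v') = false.
  by move=> vv; apply/negP => /andP[/eqP E /eqP E']; rewrite -E -E' zw eqxx in vv.
have [ax ya by_ xb] : [/\ a.1 != x.1, y.1 != a.1, b.1 != y.1 & x.1 != b.1].
  by split; rewrite eq_sym.
rewrite (nE _ _ xa) (nE _ _ ay) (nE _ _ yb) (nE _ _ bx).
by rewrite (nE _ _ ax) (nE _ _ ya) (nE _ _ by_) (nE _ _ xb) /= !mulr0n; ring.
Qed.

Variables (r1 r2 r3 : V).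
Hypotheses (r12 : cr r1 r2) (r13 : cr r1 r3) (r23 : cr r2 r3).

Definition kap : vec := edge r1 r2 + edge r1 r3 - edge r2 r3.

(** The function D of the overview, normalised to vanish at [r1]. If edges split as
    [D(x) + D(y) + const], then [kap] equals [2 * D(r1) + const], that is, the constant. A point in
    the group of [r1] is reached through [r2] instead, and its value simplifies to
    [edge x r2 - edge r1 r2]. *)
Definition pot (x : V) : vec :=
  if cr x r1 then edge x r1 - kap else edge x r2 - edge r2 r3 + edge r1 r3 - kap.

Lemma pot_r1 : pot r1 = 0.
Proof.
rewrite /pot /cr eqxx /= /kap; move: (edge _ _) (edge _ _) (edge _ _) => e1 e2 e3.
by apply/ffunP => p; rewrite !ffunE; ring.
Qed.

Let crC x y : cr x y = cr y x.
Proof. by rewrite /cr eq_sym. Qed.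

Lemma span_edge (x y : V) : cr x y -> span (edge x y - pot x - pot y - kap).
Proof.
wlog xr : x y / cr x r1.
  move=> H xy; case: (boolP (cr x r1)) => xr; first exact: H.
  have -> : edge x y - pot x - pot y - kap = edge y x - pot y - pot x - kap.
    by rewrite edgeC [_ - pot x - pot y]addrAC.
  apply: H; last by rewrite crC.
  by move: xr xy; rewrite /cr negbK => /eqP->; rewrite eq_sym.
move=> xy; case: (boolP (cr y r1)) => yr; last first.
  rewrite /pot xr (negbTE yr).
  have yE : y.1 = r1.1 by apply/eqP; rewrite -[_ == _]negbK.
  have -> : edge x y - (edge x r1 - kap) -
      (edge y r2 - edge r2 r3 + edge r1 r3 - kap) - kap =
      edge y x - edge x r1 + edge r1 r2 - edge r2 y.
    rewrite (edgeC y x) (edgeC r2 y) /kap.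
    move: (edge x y) (edge x r1) (edge y r2) (edge r2 r3) (edge r1 r3) (edge r1 r2).
    by move=> e1 e2 e3 e4 e5 e6; apply/ffunP => p; rewrite !ffunE; ring.
  by apply: span_cycle4 => //; rewrite /cr ?yE // eq_sym.
(* [r2] and [r3] lie in different groups, so one of them lies outside the group of [x]; it serves as
   [z], and the difference becomes a sum of two alternating 4-cycles. *)
have [z [z' [zx rz rz' zz' zE]]] : exists z z', [/\ cr z x, cr r1 z, cr r1 z', cr z z' &
    edge r1 r2 + edge r1 r3 - edge r2 r3 = edge r1 z + edge r1 z' - edge z z'].
  case: (boolP (cr r2 x)) => r2x; first by exists r2, r3.
  exists r3, r2; split=> //; try by rewrite crC.
    by move: r2x r23; rewrite /cr negbK => /eqP->; rewrite eq_sym.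
  by rewrite (edgeC r3) [edge r1 r2 + _]addrC.
rewrite /pot xr yr /kap zE.
have -> : edge x y - (edge x r1 - (edge r1 z + edge r1 z' - edge z z')) -
    (edge y r1 - (edge r1 z + edge r1 z' - edge z z')) -
    (edge r1 z + edge r1 z' - edge z z') =
    (edge x y - edge y r1 + edge r1 z - edge z x) +
    (edge x z - edge z z' + edge z' r1 - edge r1 x).
  rewrite (edgeC z x) (edgeC z' r1) (edgeC r1 x).
  move: (edge x y) (edge x r1) (edge r1 z) (edge r1 z') (edge z z') (edge y r1) (edge x z).
  by move=> e1 e2 e3 e4 e5 e6 e7; apply/ffunP => p; rewrite !ffunE; ring.
by apply: spanD; apply: span_cycle4 => //; rewrite crC.
Qed.

Definition degr (H : rel V) (x : V) : nat := #|[set y | H x y]|.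

(** An arbitrary order that selects one orientation of every edge. *)
Definition before (x y : V) : bool := (enum_rank x < enum_rank y)%N.

Definition esize (H : rel V) : nat := #|[set p : V * V | before p.1 p.2 && H p.1 p.2]|.

Section Graph.
Variable H : rel V.
Hypotheses (Hs : symmetric H) (Hc : forall x y, H x y -> cr x y).

Let Hb x y : H x y -> before x y = ~~ before y x.
Proof.
move=> /Hc xy; rewrite /before -leqNgt [RHS]leq_eqVlt; case: eqP => //= /ord_inj E.
by rewrite /cr (enum_rank_inj E) eqxx in xy.
Qed.

Lemma sum_before (T : nmodType) (f : V -> V -> T) :
  \sum_(p : V * V | before p.1 p.2 && H p.1 p.2) (f p.1 p.2 + f p.2 p.1) =
  \sum_(p : V * V | H p.1 p.2) f p.1 p.2.
Proof.
rewrite big_split /= [RHS](bigID (fun p => before p.1 p.2)) /=; congr (_ + _).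
  by apply: eq_bigl => p; rewrite andbC.
rewrite (reindex_inj (h := fun p : V * V => (p.2, p.1))) /=; last by move=> [a b] [c d] [-> ->].
by apply: eq_bigl => p; rewrite Hs andbC; case Hp: (H _ _) => //=; rewrite (Hb Hp) ?negbK // Hb // Hs.
Qed.

Lemma esizeE : (2 * esize H = \sum_x degr H x)%N.
Proof.
apply/eqP; rewrite -(eqr_nat int) natrM natr_sum.
have := sum_before (fun _ _ => 1 : int); rewrite sumr_const.
rewrite -[X in _ *+ X]/(#|[pred p : V * V | before p.1 p.2 && H p.1 p.2]|) -cardsE -/(esize H).
rewrite mulr_natr => E; apply/eqP; apply: etrans E _.
rewrite -(pair_big_dep xpredT (fun x y => H x y) (fun _ _ => 1 : int)) /=.
by apply: eq_bigr => x _; rewrite sumr_const /degr cardsE.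
Qed.

Definition jvec : vec := [ffun p => (H p.1 p.2)%:R].

(** Summing [span_edge] over the edges: modulo the lattice, a graph is determined by its degrees and
    its number of edges. *)
Lemma span_graph :
  span (jvec - \sum_x pot x *~ (degr H x)%:Z - kap *~ (esize H)%:Z).
Proof.
have jE : jvec = \sum_(p : V * V | before p.1 p.2 && H p.1 p.2) edge p.1 p.2.
  apply/ffunP => q; rewrite ffunE sum_ffunE.
  under eq_bigr => p _ do rewrite ffunE.
  rewrite (sum_before (fun a b => (q == (a, b))%:R)) (eq_bigr (fun p => (q == p)%:R)); last by case.
  rewrite big_mkcond (bigD1 q) //= eqxx big1 ?addr0; first by case: (H _ _).
  by move=> p pq; rewrite eq_sym (negbTE pq); case: ifP.
have dE : \sum_x pot x *~ (degr H x)%:Z =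
    \sum_(p : V * V | before p.1 p.2 && H p.1 p.2) (pot p.1 + pot p.2).
  rewrite (sum_before (fun a _ => pot a)).
  rewrite -(pair_big_dep xpredT (fun x y => H x y) (fun x _ => pot x)) /=.
  by apply: eq_bigr => x _; rewrite sumr_const /degr cardsE.
have kE : kap *~ (esize H)%:Z =
    \sum_(p : V * V | before p.1 p.2 && H p.1 p.2) kap.
  by rewrite sumr_const /esize cardsE.
rewrite jE dE kE -!sumrB; apply: span_sum => p /andP[_ Hp].
by rewrite opprD addrA; apply: span_edge; apply: Hc.
Qed.
End Graph.

Lemma degr_clique (B : {set V}) x : {in B &, injective (fun x => x.1)} ->
  degr (fun x y => [&& x \in B, y \in B & cr x y]) x = ((x \in B) * #|B|.-1)%N.
Proof.
move=> iB; rewrite /degr; case xB: (x \in B) => /=; last first.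
  by apply/eqP; rewrite mul0n cards_eq0; apply/eqP/setP => y; rewrite !inE.
rewrite mul1n (cardsD1 x B) xB add1n /=; apply: eq_card => y; rewrite !inE andbC /cr.
case yB: (y \in B); rewrite ?andbF ?andbT //; congr negb; apply/eqP/eqP => [E|-> //].
by rewrite (iB x y).
Qed.

Lemma jvec_clique (B : {set V}) : jvec (fun x y => [&& x \in B, y \in B & cr x y]) = chi B.
Proof.
apply/ffunP => p; rewrite !ffunE /ind.
by case: (p.1 \in B); case: (p.2 \in B); case: (cr _ _).
Qed.

Lemma esize_clique (B : {set V}) : {in B &, injective (fun x => x.1)} ->
  (2 * esize (fun x y => [&& x \in B, y \in B & cr x y]) = #|B| * #|B|.-1)%N.
Proof.
move=> iB; rewrite esizeE; first last.
- by move=> x y /and3P[].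
- by move=> x y; rewrite crC andbCA.
under eq_bigr => x _ do rewrite degr_clique //.
rewrite -sum_nat_const [RHS]big_mkcond; apply: eq_bigr => x _.
by case: (x \in B); rewrite ?mul1n.
Qed.

Lemma span_clique (B : {set V}) : good B ->
  span (\sum_(x in B) pot x *~ #|B|.-1%:Z + kap *~ (#|B| * #|B|.-1)./2%:Z).
Proof.
move=> gB; have /goodP[kB iB] := gB.
have := @span_graph (fun x y => [&& x \in B, y \in B & cr x y]).
rewrite jvec_clique => H.
have {H} := spanB (span_chi gB) (H _ _); rewrite -addrA -opprD subKr => H.
rewrite -esize_clique // mul2n doubleK [\sum_(x in B) _]big_mkcond.
rewrite (eq_bigr (fun x => pot x *~ (degr (fun x y => [&& x \in B, y \in B & cr x y]) x)%:Z)).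
  by apply: H => [x y|x y /and3P[]] //; rewrite crC andbCA.
by move=> x _; rewrite degr_clique //; case: (x \in B); rewrite ?mul1n.
Qed.

(** Compare two blocks of size [k] that differ only by [x] against [r1], where [pot] vanishes. *)
Lemma span_pot k x : k \in ks -> span (pot x *~ (k - 1)%N%:Z).
Proof.
move=> kk; have [k2 ku] := kg kk.
pose C := [set x.1; r1.1].
have cC : (#|C| <= 2)%N.
  by apply: leq_trans (leq_card_setU _ _) _; rewrite !cards1.
have [|A [cA iA AC]] := @rainbow_avoiding C (k - 1)%N.
  apply: leq_trans ku; apply: leq_add => //; exact: leq_subr.
have key y : y.1 \in C -> [/\ good (y |: A), y \notin A & #|y |: A| = k].
  move=> yC; have yA : y \notin A by apply/negP => /AC; rewrite yC.
  have ck : #|y |: A| = k by rewrite cardsU1 yA cA add1n subn1 prednK // ltnW.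
  split=> //; apply/goodP; rewrite ck; split=> // z t.
  rewrite !in_setU1 => /orP[/eqP->|zA] /orP[/eqP->|tA] // E.
  - by have := AC _ tA; rewrite -E yC.
  - by have := AC _ zA; rewrite E yC.
  - exact: iA.
have [gx xA cx] := key x (set21 _ _); have [gr rA crr] := key r1 (set22 _ _).
have := spanB (span_clique gx) (span_clique gr).
rewrite cx crr !big_setU1 //= pot_r1 mul0rz add0r subn1.
have -> // : forall a b c : vec, a + b + c - (b + c) = a.
by move=> a b c; rewrite -[a + b + c]addrA addrK.
Qed.

Lemma span_kap k : k \in ks -> span (kap *~ (k * k.-1)./2%:Z).
Proof.
move=> kk; have [k2 ku] := kg kk.
have [|A [cA iA _]] := @rainbow_avoiding set0 k.
  by rewrite cards0 addn0 (leq_trans _ ku) // leq_addr.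
have gA : good A by apply/goodP; rewrite cA.
have := span_clique gA; rewrite cA => S1.
have S2 : span (\sum_(x in A) pot x *~ k.-1%:Z).
  by apply: span_sum => x _; rewrite -subn1; apply: span_pot.
by have := spanB S1 S2; rewrite addrC addKr.
Qed.

Lemma degr_cr x : degr cr x = (g * (u - 1))%N.
Proof.
rewrite /degr; transitivity #|setX [set~ x.1] [set: 'I_g]|.
  by apply: eq_card => y; rewrite !inE andbT /cr eq_sym.
by rewrite cardsX cardsT cardsC1 !card_ord mulnC subn1.
Qed.

Lemma span_all :
    (forall e, (forall k, k \in ks -> e %| k - 1)%N -> (e %| g * (u - 1))%N) ->
    (forall e, (forall k, k \in ks -> e %| k * (k - 1))%N ->
       (e %| u * g * (g * (u - 1)))%N) ->
  span (jvec cr).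
Proof.
move=> Ha Hb.
have Hp x : span (pot x *~ (g * (u - 1))%N%:Z).
  apply: (@subgroup_mem (fun z => span (pot x *~ z)) [seq (k - 1)%N | k <- ks]).
  - by rewrite mulr0z; apply: span0.
  - by move=> a b; rewrite mulrzDr; apply: spanD.
  - by move=> a n; rewrite mulrzA; apply: spanZ.
  - by move=> n /mapP[k kk ->]; apply: span_pot.
  - by move=> e He; apply: Ha => k kk; apply: He; apply: map_f.
have eE : (2 * esize cr = u * g * (g * (u - 1)))%N.
  rewrite esizeE //; under eq_bigr => x _ do rewrite degr_cr.
  by rewrite sum_nat_const card_prod !card_ord.
have Hk : span (kap *~ (esize cr)%:Z).
  apply: (@subgroup_mem (fun z => span (kap *~ z)) [seq (k * k.-1)./2 | k <- ks]).
  - by rewrite mulr0z; apply: span0.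
  - by move=> a b; rewrite mulrzDr; apply: spanD.
  - by move=> a n; rewrite mulrzA; apply: spanZ.
  - by move=> n /mapP[k kk ->]; apply: span_kap.
  - move=> e He; rewrite -(@dvdn_pmul2l 2) // eE; apply: Hb => k kk.
    have /dvdnP[q qE] := He _ (map_f _ kk).
    have -> : (k * (k - 1) = 2 * (k * k.-1)./2)%N.
      by rewrite subn1 mul2n halfK; case: (k) => [|n] //=; rewrite oddM /= andNb subn0.
    by rewrite dvdn_pmul2l // qE dvdn_mull.
have := @span_graph cr crC (fun _ _ => id) => H.
have := spanD (spanD H Hk) (_ : span (\sum_x pot x *~ (degr cr x)%:Z)).
rewrite !subrK; apply; apply: span_sum => x _; rewrite degr_cr; exact: Hp.
Qed.
End Signed.

(** * From signed to nonnegative coverings *)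

Section Positive.
Local Open Scope ring_scope.
Variables (u g : nat) (ks : seq nat).
Notation V := ('I_u * 'I_g)%type.
Notation good := (@good u g ks).
Notation cr := (@cr u g).

(** Two transpositions move the groups, then one transposition inside each affected group moves the
    points. Such a map preserves good blocks, so all edges lie in equally many. *)
Lemma edge_transitive (x y x' y' : V) : cr x y -> cr x' y' ->
  exists t : V -> V, [/\ injective t, forall a b, (t a).1 = (t b).1 -> a.1 = b.1,
    t x = x' & t y = y'].
Proof.
move=> xy xy'; rewrite /cr in xy xy'.
pose p1 := tperm x.1 x'.1; pose p2 := tperm (p1 y.1) y'.1.
pose q i := if i == x.1 then tperm x.2 x'.2 else if i == y.1 then tperm y.2 y'.2 else 1%g.
exists (fun z => (p2 (p1 z.1), q z.1 z.2)); split.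
- by move=> [i a] [j b] [/perm_inj/perm_inj -> /perm_inj ->].
- by move=> a b /= /perm_inj/perm_inj.
- have p1x : p1 x.1 = x'.1 by apply: tpermL.
  rewrite p1x /p2 tpermD; last by rewrite eq_sym.
    by rewrite /q eqxx tpermL; case: (x').
  by rewrite eq_sym -p1x (inj_eq perm_inj).
- have p2y : p2 (p1 y.1) = y'.1 by apply: tpermL.
  by rewrite p2y /q eq_sym (negbTE xy) eqxx tpermL; case: (y').
Qed.

Definition ngood (x y : V) : nat := #|[set B | [&& good B, x \in B & y \in B]]|.

Lemma ngood_le (x y x' y' : V) : cr x y -> cr x' y' -> (ngood x y <= ngood x' y')%N.
Proof.
move=> xy xy'; have [t [ti tc tx ty]] := edge_transitive xy xy'.
rewrite /ngood -(card_imset _ (imset_inj ti)); apply: subset_leq_card.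
apply/subsetP => B' /imsetP[B]; rewrite !inE => /and3P[/goodP[kB iB] xB yB] ->.
rewrite -tx -ty !imset_f // !andbT; apply/goodP; rewrite card_imset //; split=> //.
by move=> a b /imsetP[c cB ->] /imsetP[d dB ->] /tc /iB ->.
Qed.

Hypotheses (g0 : (0 < g)%N) (kg : forall k, k \in ks -> (2 <= k)%N /\ (k + 2 <= u)%N).
Hypothesis ks0 : ks != [::].
Hypothesis Ha :
  forall e, (forall k, k \in ks -> e %| k - 1)%N -> (e %| g * (u - 1))%N.
Hypothesis Hb : forall e, (forall k, k \in ks -> e %| k * (k - 1))%N ->
  (e %| u * g * (g * (u - 1)))%N.

(** Write [l = N * C + m] with [m < C], where [C] counts the good blocks through an edge. Take [N]
    copies of every good block plus [m] copies of the signed solution; [N >= C * Mx] makes all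
    multiplicities nonnegative. *)
Lemma lambda_fold : exists l0, forall l, (l0 <= l)%N ->
  exists2 N : {set V} -> nat, (forall B, ~~ good B -> N B = 0%N) &
    forall x y, cr x y -> (\sum_(B : {set V} | (x \in B) && (y \in B)) N B = l)%N.
Proof.
have u4 : (4 <= u)%N.
  case: ks ks0 kg => // k s _ /(_ k (mem_head _ _))[k2 ku].
  by apply: leq_trans ku; rewrite addn2 !ltnS.
pose r i (iu : (i < u)%N) : V := (Ordinal iu, Ordinal g0).
have u3 := ltnW u4; have u2 := ltnW u3; have u1 := ltnW u2.
have [n n0 nE] := @span_all u g ks g0 kg ks0 (r 0%N u1) (r 1%N u2) (r 2%N u3)
  isT isT isT Ha Hb.
have nP x y : cr x y -> \sum_(B : {set V} | (x \in B) && (y \in B)) n B = 1.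
  move=> xy; move/ffunP/(_ (x, y)): nE; rewrite ffunE sum_ffunE /= xy => E.
  apply: etrans (esym E); rewrite big_mkcond; apply: eq_bigr => B _.
  rewrite ffunMzE ffunE /= xy /ind mulrzz.
  by case: (x \in B); case: (y \in B); rewrite ?mulr0 ?mul0r ?mul1r.
pose C := ngood (r 0%N u1) (r 1%N u2).
have CE x y : cr x y -> ngood x y = C.
  by move=> xy; apply/eqP; rewrite eqn_leq !ngood_le.
have C0 : (0 < C)%N.
  rewrite lt0n; apply: contraTneq (oner_neq0 int) => C0; rewrite negbK.
  rewrite -(nP (r 0%N u1) (r 1%N u2) isT) big1 // => B Bxy; apply: n0.
  apply/negP => gB; move/eqP: C0; rewrite cards_eq0 => /eqP/setP/(_ B).
  by rewrite !inE gB Bxy.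
pose Mx := (\sum_B `|n B|)%N.
have nM B : (`|n B| <= Mx)%N by rewrite /Mx (bigD1 B) //= leq_addr.
exists (C * Mx * C)%N => l ll.
pose m := (l %% C)%N; pose N := (l %/ C)%N.
have NM : (C * Mx <= N)%N by rewrite leq_divRL.
have mC : (m < C)%N by rewrite ltn_mod.
have pos B : 0 <= m%:Z * n B + N%:Z.
  have : (m * `|n B| <= N)%N.
    by apply: leq_trans NM; apply: leq_mul; [apply: ltnW | apply: nM].
  by rewrite -lez_nat PoszM abszE; have := ler_norm (- (m%:Z * n B)); rewrite normrN normrM; clear; lra.
exists (fun B => if good B then absz (m%:Z * n B + N%:Z) else 0%N).
  by move=> B /negbTE->.
move=> x y xy; apply/eqP; rewrite -eqz_nat -!natz natr_sum.
rewrite (eq_bigr (fun B => m%:Z * n B + (N * good B)%N%:Z)); last first.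
  move=> B _; rewrite natz; case: ifP => gB; rewrite ?muln1 ?muln0.
    by rewrite !natz gez0_abs.
  by rewrite n0 ?gB // mulr0 addr0.
rewrite big_split /= -mulr_sumr nP // mulr1.
have -> : \sum_(B : {set V} | (x \in B) && (y \in B)) (N * good B)%N%:Z = (N * C)%N%:Z.
  rewrite -(CE _ _ xy) /ngood -sum1_card big_distrr /= big_mkcond [in RHS]big_mkcond /=.
  rewrite -[RHS]natz natr_sum; apply: eq_bigr => B _; rewrite inE natz muln1.
  by case: (good B); case: (_ && _); rewrite ?muln1 ?muln0.
by rewrite -PoszD natz addnC -divn_eq.
Qed.
End Positive.

(** * Lifting coverings of prime power multiplicity *)

Section Trace.
Local Open Scope ring_scope.
Variables (F : finFieldType) (p s n : nat).
Hypotheses (pp : prime p) (s0 : (0 < s)%N) (n0 : (0 < n)%N).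
Let l := (p ^ s)%N.
Hypotheses (cF : #|F| = (l ^ n)%N).

(** The subfield of order [p ^ s], kept as a subset of [F]; [trf] is the trace from [F] to it. *)
Definition fixf := [set x : F | x ^+ (p ^ s) == x].
Definition trf (x : F) : F := \sum_(i < n) x ^+ ((p ^ s) ^ i).

Let E := fixf.
Let M := trf.

Let l1 : (1 < l)%N.
Proof. by rewrite -(exp1n s) ltn_exp2r // prime_gt1. Qed.

Let pF : p \in [pchar F].
Proof. by apply: (@card_finPcharP F p (s * n)) => //; rewrite cF expnM. Qed.

Let natl i : [pchar F].-nat (l ^ i)%N.
Proof. by rewrite !pnatX pnatE // pF. Qed.

Lemma fixfE x : x \in E -> x ^+ l = x.
Proof. by rewrite inE => /eqP. Qed.

Lemma fixf_exp x i : x \in E -> x ^+ (l ^ i) = x.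
Proof.
by move=> xE; elim: i => [|i IH]; rewrite ?expr1 // expnS mulnC exprM IH fixfE.
Qed.

Lemma fixf0 : 0 \in E.
Proof. by rewrite inE expr0n expn_eq0 -leqn0 leqNgt prime_gt0. Qed.

Lemma fixf1 : 1 \in E.
Proof. by rewrite inE expr1n. Qed.

Lemma fixfD x y : x \in E -> y \in E -> x + y \in E.
Proof.
move=> xE yE; rewrite inE -[(p ^ s)%N]/l -[l]expn1 exprDn_pchar ?natl //.
by rewrite expn1 !fixfE.
Qed.

Lemma fixfM x y : x \in E -> y \in E -> x * y \in E.
Proof. by move=> xE yE; rewrite inE exprMn !fixfE. Qed.

Lemma fixfV x : x \in E -> x^-1 \in E.
Proof. by move=> xE; rewrite inE exprVn fixfE. Qed.

Lemma fixfN x : x \in E -> - x \in E.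
Proof.
move=> xE; rewrite inE; apply/eqP/(@addrI _ (x ^+ l)); rewrite [in RHS]fixfE // subrr.
by rewrite -[l]expn1 -exprDn_pchar ?natl // subrr expr0n expn1 -leqn0 leqNgt ltnW.
Qed.

Lemma trfD x y : M (x + y) = M x + M y.
Proof.
by rewrite /M /trf -big_split; apply: eq_bigr => i _; rewrite exprDn_pchar ?natl.
Qed.

Lemma trf0 : M 0 = 0.
Proof. by apply: (@addrI _ (M 0)); rewrite -trfD !addr0. Qed.

Lemma trfN x : M (- x) = - M x.
Proof. by apply: (@addrI _ (M x)); rewrite -trfD !subrr trf0. Qed.

Lemma trfB x y : M (x - y) = M x - M y.
Proof. by rewrite trfD trfN. Qed.

Lemma trf_sum (I : Type) (r : seq I) (f : I -> F) :
  M (\sum_(i <- r) f i) = \sum_(i <- r) M (f i).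
Proof. by elim/big_rec2: _ => [|i a b _ <-]; rewrite ?trf0 ?trfD. Qed.

Lemma trfZ e x : e \in E -> M (e * x) = e * M x.
Proof.
move=> eE; rewrite /M /trf big_distrr; apply: eq_bigr => i _.
by rewrite exprMn fixf_exp.
Qed.

Lemma trf_fix x : M x \in E.
Proof.
have H : M x ^+ l = \sum_(i < n) x ^+ (l ^ i.+1).
  rewrite /M /trf.
  elim/big_rec2: _ => [|i a b _ <-].
    by rewrite expr0n -leqn0 leqNgt ltnW.
  rewrite -[X in _ ^+ X]expn1 exprDn_pchar ?natl //.
  by rewrite expn1 -exprM -expnSr.
rewrite inE; apply/eqP; apply: etrans H _; rewrite /M /trf.
case: n n0 cF => // n' _ cF'; rewrite big_ord_recr [RHS]big_ord_recl /=.
by rewrite -cF' expf_card expr1 addrC.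
Qed.

Lemma trf_trf x y : M (M x * y) = M x * M y.
Proof. by rewrite trfZ ?trf_fix. Qed.

Lemma card_trf_fiber e : (#|[set x | M x == e]| <= l ^ n.-1)%N.
Proof.
pose Q : {poly F} := \sum_(i < n) 'X^(l ^ i) - e%:P.
have lp i : (0 < l ^ i)%N by rewrite expn_gt0 ltnW.
have Qc : Q`_(l ^ n.-1) = 1.
  rewrite coefB coefC -leqn0 leqNgt lp subr0 coef_sum.
  have nn : (n.-1 < n)%N by rewrite prednK.
  rewrite (bigD1 (Ordinal nn)) //= coefXn eqxx big1 ?addr0 // => i ni.
  rewrite coefXn; case: eqP => // /eqP; rewrite eqn_exp2l // => /eqP E'.
  by case/eqP: ni; apply: val_inj.
have Q0 : Q != 0 by apply: contra_eq_neq Qc => ->; rewrite coef0 eq_sym oner_neq0.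
have sQ : (size Q <= (l ^ n.-1).+1)%N.
  apply: leq_trans (size_polyD _ _) _; rewrite size_polyN geq_max; apply/andP; split.
    apply: leq_trans (size_sum _ _ _) _; apply/bigmax_leqP => i _.
    by rewrite size_polyXn ltnS leq_exp2l // -ltnS prednK.
  by apply: leq_trans (size_polyC_leq1 _) _.
rewrite cardE -ltnS; apply: leq_trans sQ; apply: max_poly_roots => //; last exact: enum_uniq.
apply/allP => x; rewrite mem_enum inE => /eqP xe; rewrite rootE hornerD hornerN hornerC.
rewrite horner_sum; under eq_bigr => i _ do rewrite hornerXn.
by rewrite -xe subrr.
Qed.

(** The lower bound comes from the trace: its values lie in [E] and each fibre has at most
    [l ^ n.-1] elements, being roots of a polynomial of that degree. *)
Lemma card_fixf : #|E| = l.
Proof.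
apply/eqP; rewrite eqn_leq; apply/andP; split.
  pose Q : {poly F} := 'X^l - 'X.
  have sQ : size Q = l.+1 by rewrite size_polyDl ?size_polyXn // size_polyN size_polyX.
  rewrite -ltnS -sQ cardE; apply: max_poly_roots; last exact: enum_uniq.
    by rewrite -size_poly_eq0 sQ.
  apply/allP => x; rewrite mem_enum inE => /eqP xe.
  by rewrite rootE hornerD hornerN hornerXn hornerX xe subrr.
have : (#|F| <= #|E| * l ^ n.-1)%N.
  rewrite -sum_nat_const -sum1_card (partition_big M (mem E)) /=; last first.
    by move=> x _; apply: trf_fix.
  apply: leq_sum => e _.
  by rewrite sum1_card; apply: leq_trans (card_trf_fiber e); rewrite -cardsE.
rewrite cF -{1}(prednK n0) expnS leq_pmul2r //.
by rewrite expn_gt0 ltnW.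
Qed.

Lemma trf_neq0 : exists x, M x != 0.
Proof.
apply/existsP; apply: contraTT (card_trf_fiber 0); rewrite negb_exists => /forallP H.
rewrite [X in #|pred_of_set X|](_ : _ = setT); last first.
  by apply/setP => x; rewrite !inE -[_ == _]negbK H.
by rewrite cardsT cF -ltnNge ltn_exp2l // ltn_predL.
Qed.

(** * Trace duality and nodes in general position *)

Section Dual.
Variable I : finType.

Definition indep (t : seq I) (r : I -> F) := forall mu : I -> F,
  (forall y, mu y \in E) -> \sum_(y <- t) mu y * r y = 0 -> forall y, y \in t -> mu y = 0.

(** Nondegeneracy of the trace form, proved by a Gram-Schmidt step for each new vector. *)
Lemma indep_dual (t : seq I) (r : I -> F) : uniq t -> indep t r ->
  forall tau : I -> F, (forall y, tau y \in E) ->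
  exists v, forall y, y \in t -> M (v * r y) = tau y.
Proof.
elim: t => [|x t IH] /=; first by exists 0.
move=> /andP[xt ut] ind tau tauE.
have indt : indep t r.
  move=> mu muE mu0 y yt.
  have := ind (fun z => if z == x then 0 else mu z) _ _ y.
  rewrite inE yt orbT; case: (eqVneq y x) => [yx|_]; first by rewrite yx (negbTE xt) in yt.
  apply=> //; first by move=> z; case: ifP => _; rewrite ?fixf0.
  rewrite big_cons eqxx mul0r add0r -[RHS]mu0; apply: eq_big_seq => z zt.
  by case: eqP => // zx; rewrite -zx zt in xt.
have dl y : exists v, forall z, z \in t -> M (v * r z) = (z == y)%:R.
  by apply: (IH ut indt (fun z => (z == y)%:R)) => z; case: eqP => _; rewrite ?fixf0 ?fixf1.
have [w wP] := fin_all_exists dl.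
(* [w] is dual to the tail, so [rho] is [r x] minus an [E]-combination of the tail, nonzero by
   independence. *)
pose rho := r x - \sum_(y <- t) M (w y * r x) * r y.
have rho0 : rho != 0.
  apply/eqP => rho0; pose mu z := if z == x then 1 else - M (w z * r x).
  have /(_ x (mem_head _ _)) : forall y, y \in x :: t -> mu y = 0.
    apply: ind; first by move=> z; rewrite /mu; case: ifP => _; rewrite ?fixf1 // fixfN ?trf_fix.
    rewrite big_cons /mu eqxx mul1r -[RHS]rho0 /rho -sumrN; congr (_ + _).
    apply: eq_big_seq => z zt; case: eqP => [zx|_]; last by rewrite mulNr.
    by rewrite -zx zt in xt.
  by rewrite /mu eqxx => /eqP; rewrite oner_eq0.
have [v0 v0P] := trf_neq0.
have [v Mv] : exists v, M (v * rho) != 0 by exists (v0 / rho); rewrite divfK.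
(* [v'] is trace-orthogonal to the tail while its pairing with [r x] remains nonzero; a multiple of
   it by a scalar of [E] corrects the value at [x]. *)
pose v' := v - \sum_(y <- t) M (v * r y) * w y.
have v't z : z \in t -> M (v' * r z) = 0.
  move=> zt; rewrite mulrBl trfB mulr_suml trf_sum.
  rewrite (bigD1_seq z) //= -mulrA trf_trf wP // eqxx mulr1.
  rewrite big1_seq ?addr0 ?subrr // => y /andP[yz yt].
  by rewrite -mulrA trf_trf wP // eq_sym (negbTE yz) mulr0.
have v'x : M (v' * r x) = M (v * rho).
  rewrite /v' /rho mulrBl mulrBr !trfB mulr_suml mulr_sumr !trf_sum; congr (_ - _).
  apply: eq_bigr => y _; rewrite -mulrA trf_trf mulrCA trf_trf.
  by rewrite mulrC.
have [v1 v1P] := IH ut indt _ tauE.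
pose c := (tau x - M (v1 * r x)) / M (v * rho).
have cE : c \in E by rewrite fixfM ?fixfV ?trf_fix // fixfD // fixfN ?trf_fix.
exists (v1 + c * v') => y; rewrite inE mulrDl trfD -(mulrA c) (trfZ _ cE).
case/orP=> [/eqP->|yt]; first by rewrite v'x divfK // addrC subrK.
by rewrite v't // mulr0 addr0 v1P.
Qed.

(** General position adapted to induction: the head only has to be independent of the nodes after
    it, since [lift_labels] chooses its value last. *)
Fixpoint chain (e : I -> F) (t : seq I) : Prop :=
  if t is x :: t' then
    [/\ forall y, y \in t' -> e x != e y, indep t' (fun y => (e x - e y)^-1) & chain e t']
  else True.

Lemma eq_chain e e' t : {in t, e =1 e'} -> chain e t -> chain e' t.
Proof.
elim: t => //= x t IH ee [h1 h2 h3].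
have et y : y \in t -> e y = e' y by move=> yt; apply: ee; rewrite inE yt orbT.
have ex := ee x (mem_head _ _); split.
- by move=> y yt; rewrite -ex -et // h1.
- move=> mu muE mu0; apply: h2 => //; rewrite -[RHS]mu0; apply: eq_big_seq => y yt.
  by rewrite ex et.
- exact: IH.
Qed.

Lemma chain_inj e t : chain e t -> {in t &, injective e}.
Proof.
elim: t => //= x t IH [h1 _ h3] y z; rewrite !inE.
case/orP=> [/eqP->|yt] /orP[/eqP->|zt] // ee.
- by have := h1 _ zt; rewrite ee eqxx.
- by have := h1 _ yt; rewrite ee eqxx.
- exact: IH.
Qed.

(** The numerator of the sum of the fractions [mu y / (X - e y)]. A dependence between the inverses
    [1 / (z - e y)] makes [z] a root of it. *)
Definition pfrac (e : I -> F) (t : seq I) (mu : I -> F) : {poly F} :=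
  \sum_(y <- t) mu y *: \prod_(z <- t | z != y) ('X - (e z)%:P).

Lemma size_pfrac e t mu : (size (pfrac e t mu) <= (size t).+1)%N.
Proof.
apply: leq_trans (size_sum _ _ _) _; apply/bigmax_leqP_seq => y _ _.
apply: leq_trans (size_scale_leq _ _) _; rewrite -big_filter size_prod_XsubC ltnS.
by rewrite size_filter count_size.
Qed.

Lemma pfrac_neq0 e t mu y : uniq t -> {in t &, injective e} -> y \in t -> mu y != 0 ->
  pfrac e t mu != 0.
Proof.
move=> ut ei yt muy; apply/eqP => /(congr1 (fun q => q.[e y])); rewrite horner0.
rewrite horner_sum (bigD1_seq y) //= [X in _ + X]big1_seq ?addr0; last first.
  move=> z /andP[zy zt]; apply/eqP; rewrite hornerZ horner_prod mulf_eq0 prodf_seq_eq0.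
  apply/orP; right; apply/hasP; exists y => //.
  by rewrite eq_sym zy hornerXsubC subrr eqxx.
apply/eqP; rewrite hornerZ horner_prod mulf_neq0 // prodf_seq_neq0.
apply/allP => z zt; apply/implyP => zy; rewrite hornerXsubC subr_eq0.
by apply: contraNneq zy => /ei ->.
Qed.

Lemma pfrac_eval e t mu z : uniq t -> (forall y, y \in t -> z != e y) ->
    \sum_(y <- t) mu y * (z - e y)^-1 = 0 ->
  (pfrac e t mu).[z] = 0.
Proof.
move=> ut ze H; pose P := \prod_(y <- t) (z - e y).
have -> : (pfrac e t mu).[z] = P * \sum_(y <- t) mu y * (z - e y)^-1.
  rewrite horner_sum big_distrr /=; apply: eq_big_seq => y yt.
  rewrite hornerZ horner_prod /P (bigD1_seq y) //= [RHS]mulrC -!mulrA; congr (_ * _).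
  rewrite mulKf; first by apply: eq_bigr => i _; rewrite hornerXsubC.
  by rewrite subr_eq0 ze.
by rewrite H mulr0.
Qed.

(** A new node has to avoid the roots of [pfrac] for each of at most [l ^ #|I|] coefficient vectors,
    and the earlier nodes; the size of [F] leaves a free element. *)
Lemma chain_exists (t : seq I) : uniq t ->
  ((l ^ #|I|) * #|I|.+1 + #|I| < #|F|)%N -> exists e, chain e t.
Proof.
move=> + Fbig; elim: t => [|x t IH] /=; first by exists (fun=> 0).
move=> /andP[xt ut]; have [e ch] := IH ut; have ei := chain_inj ch.
have tI : (size t <= #|I|)%N by rewrite -(card_uniqP ut) max_card.
pose S := [set mu : {ffun I -> F} | (mu \in ffun_on (mem E)) && has (fun y => mu y != 0) t].
pose rts (mu : {ffun I -> F}) := [set z | root (pfrac e t mu) z].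
pose bad := (\bigcup_(mu in S) rts mu) :|: [set e y | y in t].
have cS : (#|S| <= l ^ #|I|)%N.
  have <- : #|(ffun_on (mem E) : pred {ffun I -> F})| = (l ^ #|I|)%N by rewrite card_ffun_on card_fixf.
  apply: subset_leq_card.
  by apply/subsetP => mu; rewrite inE => /andP[].
have crt mu : mu \in S -> (#|rts mu| <= #|I|.+1)%N.
  rewrite inE => /andP[_ /hasP[y yt muy]].
  apply: leq_trans (_ : (size t).+1 <= _)%N; last by rewrite ltnS.
  apply: leq_trans (size_pfrac e t mu); apply: ltnW; rewrite cardE.
  apply: max_poly_roots; last exact: enum_uniq.
    exact: pfrac_neq0 yt muy.
  by apply/allP => z; rewrite mem_enum inE.
have cbad : (#|bad| < #|F|)%N.
  apply: leq_ltn_trans Fbig; apply: leq_trans (leq_card_setU _ _) _; apply: leq_add.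
    apply: leq_trans (_ : \sum_(mu in S) #|I|.+1 <= _)%N; last first.
      by rewrite sum_nat_const leq_mul2r cS orbT.
    apply: leq_trans (_ : \sum_(mu in S) #|rts mu| <= _)%N; last exact: leq_sum.
    elim/big_ind2: _ => [|A a B b HA HB|//]; first by rewrite cards0.
    by apply: leq_trans (leq_card_setU _ _) _; apply: leq_add.
  apply: leq_trans (leq_imset_card _ _) _; exact: max_card.
have [z _ zb] : exists2 z, z \in [set: F] & z \notin bad.
  apply/subsetPn; apply: contraL cbad => /subset_leq_card.
  by rewrite cardsT -leqNgt.
have zt y : y \in t -> z != e y.
  by move=> yt; apply: contraNneq zb => ->; rewrite inE; apply/orP; right; apply/imsetP; exists y.
have et : {in t, e =1 (fun y => if y == x then z else e y)}.
  by move=> y yt; case: eqP => // yx; rewrite -yx yt in xt.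
exists (fun y => if y == x then z else e y); rewrite eqxx; split.
- by move=> y yt; rewrite -et ?zt.
- move=> mu muE mu0.
  have {}mu0 : \sum_(y <- t) mu y * (z - e y)^-1 = 0.
    by rewrite -[RHS]mu0; apply: eq_big_seq => y yt; rewrite -et.
  move=> y yt; apply/eqP/negPn/negP => muy.
  case/negP: zb; rewrite inE; apply/orP; left; apply/bigcupP; exists (finfun mu).
    rewrite inE; apply/andP; split; first by apply/ffun_onP => i; rewrite ffunE.
    by apply/hasP; exists y => //; rewrite ffunE.
  rewrite inE rootE; apply/eqP; apply: pfrac_eval => //; rewrite -[RHS]mu0.
  by apply: eq_bigr => i _; rewrite ffunE.
- exact: eq_chain ch.
Qed.

(** Once the tail is settled, each condition on the value [v] at the head prescribes the trace of
    [v / (e x - e y)], and [indep_dual] meets all of them at once. *)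
Lemma lift_labels e t : uniq t -> chain e t ->
  forall lab : I -> I -> F, (forall x y, lab x y \in E) -> (forall x y, lab x y = lab y x) ->
  exists c : I -> F, forall x y, x \in t -> y \in t -> x != y ->
    M ((c x - c y) / (e x - e y)) = lab x y.
Proof.
move=> + + lab labE labC; elim: t => [|x t IH] /=; first by exists (fun=> 0).
move=> /andP[xt ut] [h1 h2 h3]; have [c cP] := IH ut h3.
have [|v vP] := indep_dual ut h2 (tau := fun y => lab x y + M (c y / (e x - e y))).
  by move=> y; rewrite fixfD ?trf_fix.
have swap a b a' b' : M ((a - b) / (a' - b')) = M ((b - a) / (b' - a')).
  by rewrite -opprB -[a' - b']opprB invrN mulrNN.
exists (fun y => if y == x then v else c y) => y z.
rewrite !inE; case: (eqVneq y x) => [->|yx] /=; case: (eqVneq z x) => [->|zx] //=.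
- by move=> _ zt _; rewrite mulrBl trfB vP // addrK.
- by move=> yt _ _; rewrite swap mulrBl trfB vP // addrK labC.
- exact: cP.
Qed.
End Dual.

(** * Blow-up of an l-fold covering by the field *)

Section Blowup.
Variables (K : nat -> Prop) (u g : nat) (ks : seq nat).
Notation V := ('I_u * 'I_g)%type.
Notation good := (@good u g ks).
Notation cr := (@cr u g).
Variable N : {set V} -> nat.
Hypotheses (Kks : forall k, k \in ks -> K k) (Ngood : forall B, ~~ good B -> N B = 0%N).
Hypothesis Nl : forall x y, cr x y ->
  (\sum_(B : {set V} | (x \in B) && (y \in B)) N B = l)%N.
Hypothesis Fbig : ((l ^ #|{: V}|) * #|{: V}|.+1 + #|{: V}| < #|F|)%N.

(* The [l] blocks through a pair [x], [y] get distinct labels in the subfield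
   of order [l], and every copy is lifted so that its slope along [x], [y] has
   trace equal to the label; translating the slope by the kernel of the trace
   then covers every difference over [x], [y] once. *)
Lemma GDD_lift : GDD K u (g * #|F|).
Proof.
pose J := {B : {set V} & 'I_(N B)}.
have gJ (j : J) : good (tag j).
  by apply/negPn/negP => /Ngood N0; case: j N0 => B [i iN] /= N0; rewrite N0 in iN.
pose Jxy (x y : V) := [set j : J | (x \in tag j) && (y \in tag j)].
have cJ x y : cr x y -> #|Jxy x y| = l.
  move=> /Nl <-; rewrite -sum1_card.
  rewrite (partition_big (fun j : J => tag j) (fun B : {set V} => (x \in B) && (y \in B))) /=; last first.
    by move=> j; rewrite inE.
  apply: eq_bigr => B Bxy; rewrite -(card_fib_tag N B) -sum1_card.
  apply: eq_bigl => j; rewrite !inE; case: eqP => [->|]; last by rewrite andbF.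
  by rewrite Bxy.
have [e ch] := chain_exists (enum_uniq {: V}) Fbig.
have ei x y : e x = e y -> x = y.
  by apply: (chain_inj ch); rewrite mem_enum.
(* The position of [j] among the copies through [x] and [y], read in an enumeration of [E]. The
   default 0 also lies in [E], so labels are available for every [j] and every pair, as
   [lift_labels] demands. *)
pose lab (j : J) x y := nth 0 (enum E) (index j (enum (Jxy x y))).
have JC x y : Jxy x y = Jxy y x by apply/setP => j; rewrite !inE andbC.
have labE j x y : lab j x y \in E.
  rewrite /lab; case: (ltnP (index j (enum (Jxy x y))) (size (enum E))) => H.
    by rewrite -mem_enum mem_nth.
  by rewrite nth_default // fixf0.
have labC j x y : lab j x y = lab j y x by rewrite /lab JC.
have labI x y j j' : cr x y -> j \in Jxy x y -> j' \in Jxy x y ->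
    lab j x y = lab j' x y -> j = j'.
  move=> xy jJ jJ' /eqP; rewrite /lab nth_uniq ?enum_uniq -?cardE ?card_fixf
    -?(cJ _ _ xy) ?cardE ?index_mem ?mem_enum //.
  move=> /eqP E'; rewrite -[j](nth_index j (s := enum (Jxy x y))) ?mem_enum // E'.
  by rewrite nth_index ?mem_enum.
have labS x y t : cr x y -> t \in E -> exists2 j, j \in Jxy x y & lab j x y = t.
  move=> xy tE; have it : (index t (enum E) < size (enum (Jxy x y)))%N.
    by rewrite -cardE (cJ _ _ xy) -card_fixf cardE index_mem mem_enum.
  have [j0 _] : exists j : J, true by case: (enum (Jxy x y)) it => // j; exists j.
  exists (nth j0 (enum (Jxy x y)) (index t (enum E))); first by rewrite -mem_enum mem_nth.
  by rewrite /lab index_uniq ?enum_uniq // nth_index // mem_enum.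
have lift j : exists c : V -> F, forall x y, x != y ->
    M ((c x - c y) / (e x - e y)) = lab j x y.
  have [c cP] := lift_labels (enum_uniq {: V}) ch (labE j) (labC j).
  by exists c => x y xy; apply: cP; rewrite ?mem_enum.
have {lift} [c cP] := fin_all_exists lift.
have crn x y : cr x y -> x != y by apply: contraTneq => ->; rewrite /cr eqxx.
have ce x y : cr x y -> e x - e y != 0.
  by move=> /crn xy; rewrite subr_eq0; apply: contraNneq xy => /ei ->.
apply: (@GDD_intro _ _ _ (V * F)%type _ (fun z => z.1.1) setT).
- by rewrite cardsT card_ord.
- move=> i _; rewrite (card_fib_comp (fun z : V * F => z.1) (fun x : V => x.1)).
  under eq_bigr => x _ do rewrite card_fib_fst.
  rewrite sum_nat_cond_const; congr (_ * _)%N.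
  rewrite -[RHS](card_ord g) -(card_fib_fst 'I_g i).
  by apply: eq_card => x; rewrite !inE.
pose f (q : J * F * F) (x : V) : V * F := (x, c q.1.1 x + q.1.2 * e x + q.2).
pose blk q := [set f q x | x in tag q.1.1].
have fi q : injective (f q) by move=> x y [].
have blkP q x a : ((x, a) \in blk q) = (x \in tag q.1.1) && (a == c q.1.1 x + q.1.2 * e x + q.2).
  apply/imsetP/andP => [[y yB [-> ->]]|[xB /eqP->]]; first by rewrite yB eqxx.
  by exists x.
exists [set blk q | q in [set q : J * F * F | M q.1.2 == 0]]; split.
- move=> b /imsetP[q _ ->]; rewrite card_imset //.
  by have /andP[kB _] := gJ q.1.1; apply: Kks.
- move=> b [x a] [y d] /imsetP[q _ ->]; rewrite !blkP => /andP[xB /eqP->] /andP[yB /eqP->].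
  move=> xy; rewrite /cross !inE /=; apply: contraNneq xy => E1.
  by have /goodP[_ iB] := gJ q.1.1; rewrite (iB x y xB yB E1).
- move=> [x a] [y d]; rewrite /cross !inE /= => xy.
  have [j jJ jE] := labS x y (M ((a - d) / (e x - e y))) xy (trf_fix _).
  pose m := (a - d - (c j x - c j y)) / (e x - e y).
  have mE : m * (e x - e y) = a - d - (c j x - c j y) by rewrite divfK // ce.
  have m0 : M m == 0 by rewrite /m mulrBl trfB (cP j) ?crn // jE subrr.
  move: jJ; rewrite inE => /andP[xj yj].
  exists (blk (j, m, a - c j x - m * e x)); first by rewrite imset_f // inE.
  rewrite !blkP xj yj /=; apply/andP; split; apply/eqP; first by ring.
  apply/eqP; rewrite -subr_eq0; apply/eqP.
  transitivity (m * (e x - e y) - (a - d - (c j x - c j y))); first by ring.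
  by rewrite mE subrr.
move=> b b' [x a] [y d] /imsetP[[[j m] v] + ->] /imsetP[[[j' m'] v'] + ->].
rewrite !inE /= => /eqP m0 /eqP m0' xy; rewrite !blkP /=.
move=> /andP[xj /eqP aE] /andP[yj /eqP dE] /andP[xj' /eqP aE'] /andP[yj' /eqP dE'].
have xyc : cr x y.
  rewrite /cr; apply: contraNneq xy => E1; have /goodP[_ iB] := gJ j.
  by have E2 := iB x y xj yj E1; rewrite aE dE E2.
have e0 := ce _ _ xyc.
have key j1 m1 v1 : M m1 = 0 -> a = c j1 x + m1 * e x + v1 -> d = c j1 y + m1 * e y + v1 ->
    lab j1 x y = M ((a - d) / (e x - e y)).
  move=> M0 -> ->; rewrite -cP ?crn //.
  have -> : c j1 x + m1 * e x + v1 - (c j1 y + m1 * e y + v1) =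
    (c j1 x - c j1 y) + m1 * (e x - e y) by ring.
  by rewrite [in RHS]mulrDl mulfK // trfD M0 addr0.
have jj : j = j'.
  apply: (labI x y) => //; rewrite ?inE ?xj ?xj' //.
  by rewrite (key _ _ _ m0 aE dE) (key _ _ _ m0' aE' dE').
subst j'; have mm : m = m'.
  apply: (mulIf e0).
  have : c j x + m * e x + v - (c j y + m * e y + v) - (c j x - c j y) =
         c j x + m' * e x + v' - (c j y + m' * e y + v') - (c j x - c j y).
    by rewrite -aE -dE -aE' -dE'.
  by move=> H; apply: etrans (etrans _ H) _; ring.
by subst m'; move: aE'; rewrite aE => /addrI ->.
Qed.
End Blowup.
End Trace.

Lemma GDD_blowup K u g (ks : seq nat) :
    (forall k, k \in ks -> K k) -> ks != [::] -> 0 < g ->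
    (forall k, k \in ks -> 2 <= k /\ k + 2 <= u) ->
    (forall e, (forall k, k \in ks -> e %| k - 1) -> e %| g * (u - 1)) ->
    (forall e, (forall k, k \in ks -> e %| k * (k - 1)) -> e %| u * g * (g * (u - 1))) ->
  exists l0, forall p s, prime p -> 0 < s -> l0 <= p ^ s ->
    exists n0, forall n, n0 <= n -> GDD K u (g * (p ^ s) ^ n).
Proof.
move=> Kks ks0 g0 kg Ha Hb.
have [l0 l0P] := lambda_fold g0 kg ks0 Ha Hb; exists l0 => p s pp s0 ls.
have [N Ng Nl] := l0P _ ls.
(* Since [n < (p ^ s) ^ n], any [n >= b] makes the field as large as [GDD_lift] requires. *)
pose v := #|{: 'I_u * 'I_g}|; pose b := ((p ^ s) ^ v * v.+1 + v).+1.
exists b => n bn.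
have n0 : 0 < n by apply: leq_trans bn.
have sn0 : 0 < s * n by rewrite muln_gt0 s0.
have [F _ cF] := PrimePowerField pp sn0.
rewrite expnM in cF; rewrite -cF; apply: (GDD_lift pp s0 n0 cF Kks Ng Nl).
rewrite cF; apply: leq_trans bn _; apply: ltnW; apply: ltn_expl.
by rewrite -(exp1n s) ltn_exp2r // prime_gt1.
Qed.

(** * Weighted affine spaces *)

Section AffineSpace.
Local Open Scope ring_scope.
Variables (F : finFieldType) (D : nat).
Notation Om := 'rV[F]_D.

Definition aline (x v : Om) : {set Om} := [set x + t *: v | t in F].

Lemma aline_through (x v a b : Om) : a \in aline x v -> b \in aline x v -> a != b ->
  aline x v = aline a (b - a).
Proof.
move=> /imsetP[s _ ->] /imsetP[t _ ->] ne.
have st : t - s != 0.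
  by rewrite subr_eq0; apply: contraNneq ne => ->.
have E : x + t *: v - (x + s *: v) = (t - s) *: v.
  by rewrite opprD addrACA subrr add0r scalerBl.
rewrite E; apply/setP => z; apply/imsetP/imsetP => -[r _ ->].
  exists ((r - s) / (t - s)) => //.
  by rewrite scalerA divfK // -addrA -scalerDl [s + _]addrC subrK.
exists (s + r * (t - s)) => //.
by rewrite [(s + _) *: v]scalerDl addrA scalerA.
Qed.

Definition alines : {set {set Om}} := [set aline p.1 p.2 | p in [set p : Om * Om | p.2 != 0]].

Lemma decomp_alines : decomp (eq #|F|) (fun x y => x != y) alines.
Proof.
split.
- move=> b /imsetP[[x v]]; rewrite inE /= => v0 ->; rewrite card_imset //.
  move=> s t /addrI /eqP; rewrite -subr_eq0 -scalerBl scaler_eq0 (negbTE v0) orbF.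
  by rewrite subr_eq0 => /eqP.
- by [].
- move=> x y xy; exists (aline x (y - x)).
    by apply/imsetP; exists (x, y - x); rewrite // inE subr_eq0 eq_sym.
  apply/andP; split; apply/imsetP; first by exists 0; rewrite // scale0r addr0.
  by exists 1; rewrite // scale1r addrC subrK.
- move=> b b' x y /imsetP[p _ ->] /imsetP[p' _ ->] xy xb yb xb' yb'.
  by rewrite (aline_through xb yb xy) (aline_through xb' yb' xy).
Qed.

(** Fewer than [D] linear conditions have a nonzero solution [v], by counting, and [S] is its
    orthogonal. Being linear, [S] contains the origin, whose weight may vanish, so a point outside
    [S] has the positive weight [g]. *)
Lemma hyperplane (Y : {set Om}) : (#|Y| < D)%N -> exists S : {set Om},
  [/\ Y \subset S, 0 \in S, exists x, x \notin S &
    forall l x y, l \in alines -> x \in l -> y \in l -> x != y -> x \in S -> y \in S ->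
      l \subset S].
Proof.
move=> YD.
pose dot (x w : Om) := \sum_i x 0 i * w 0 i.
have dotD x y w : dot (x + y) w = dot x w + dot y w.
  by rewrite /dot -big_split; apply: eq_bigr => i _; rewrite mxE mulrDl.
have dotZ t x w : dot (t *: x) w = t * dot x w.
  by rewrite /dot big_distrr; apply: eq_bigr => i _; rewrite /= mxE mulrA.
have dotB x w w' : dot x (w - w') = dot x w - dot x w'.
  by rewrite /dot -sumrB; apply: eq_bigr => i _; rewrite !mxE mulrBr.
pose phi (w : Om) : {ffun 'I_#|Y| -> F} := [ffun i => dot (enum_val i) w].
have : ~~ injectiveb phi.
  apply/negP => /injectiveP/leq_card.
  have -> : #|{: Om}| = (#|F| ^ D)%N by rewrite card_mx mul1n.
  have -> : #|{: {ffun 'I_#|Y| -> F}}| = (#|F| ^ #|Y|)%N by rewrite card_ffun card_ord.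
  rewrite leqNgt.
  rewrite ltn_exp2l ?YD //.
  exact: finNzRing_gt1.
case/injectivePn=> w [w' ww' /ffunP E].
pose v := w - w'.
have v0 : v != 0 by rewrite subr_eq0.
have vY y : y \in Y -> dot y v = 0.
  move=> yY; have := E (enum_rank_in yY y); rewrite !ffunE enum_rankK_in //.
  by rewrite dotB => ->; rewrite subrr.
have d0 : dot 0 v = 0 by rewrite /dot big1 // => i _; rewrite mxE mul0r.
exists [set x | dot x v == 0]; split.
- by apply/subsetP => y /vY yv; rewrite inE yv.
- by rewrite inE d0.
- have [i vi] : exists i, v 0 i != 0.
    apply/existsP; apply: contraNT v0; rewrite negb_exists => /forallP H.
    apply/eqP/rowP => i; rewrite [RHS]mxE; apply/eqP; rewrite -[_ == _]negbK; exact: H.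
  exists (delta_mx 0 i); rewrite inE /dot (bigD1 i) //= mxE !eqxx mul1r big1 ?addr0 //.
  by move=> j ji; rewrite mxE (negbTE ji) mul0r.
- move=> l x y /imsetP[p _ ->] xl yl xy; rewrite !inE => /eqP xv /eqP yv.
  rewrite (aline_through xl yl xy); apply/subsetP => z /imsetP[t _ ->].
  by rewrite inE dotD dotZ -scaleN1r dotD dotZ xv yv !(mulr0, addr0).
Qed.
End AffineSpace.

Lemma is_PBD_decomp K v (B : {set {set 'I_v}}) :
  decomp K (fun x y => x != y) B -> is_PBD K B.
Proof.
move=> [h1 _ h3 h4]; split=> // x y xy; have [b bB /andP[xb yb]] := h3 _ _ xy.
apply/eqP/cards1P; exists b; apply/setP => b'; rewrite !inE.
apply/idP/eqP => [/and3P[b'B xb' yb']|->]; last by rewrite bB xb yb.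
exact: h4 b'B bB xy xb' yb' xb yb.
Qed.

Lemma weighting (T : finType) (wt : T -> nat) v : v = \sum_t wt t ->
  exists pr : 'I_v -> T, forall t, #|fib pr t| = wt t.
Proof.
pose W := {t : T & 'I_(wt t)} => vE.
have cW : #|{: W}| = v.
  rewrite card_tagged sumnE big_map big_enum vE.
  by apply: eq_bigr => t _; rewrite card_ord.
pose f (i : 'I_v) : W := enum_val (cast_ord (esym cW) i).
have fi : injective f by move=> i j /enum_val_inj/cast_ord_inj.
exists (fun i => tag (f i)) => t; rewrite -(card_fib_tag wt t) -(card_imset _ fi).
apply: eq_card => x; rewrite inE; apply/imsetP/idP => [[i]|xt].
  by rewrite inE => /eqP it ->; rewrite /= it.
have fx : f (cast_ord cW (enum_rank x)) = x by rewrite /f cast_ordK enum_rankK.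
by exists (cast_ord cW (enum_rank x)); rewrite ?inE ?fx.
Qed.

(* Points of the affine space get weight [g], except the origin which gets [h];
   a point at infinity is added and the groups are filled. Hyperplanes through
   the origin lift to proper subspaces. *)
Lemma pbd_dimension K (F : finFieldType) D d g h v :
    d < D -> 0 < g -> GDD K #|F| g -> GDDh K #|F|.-1 g h ->
    pbd K (g + 1) -> pbd K (h + 1) -> v = g * (#|F| ^ D - 1) + h + 1 ->
  exists B : {set {set 'I_v}}, is_PBD K B /\ dim_at_least B d.
Proof.
move=> dD g0 dF dh pg ph vE.
pose Om := 'rV[F]_D; pose o0 : Om := 0%R.
pose wt (o : option Om) := if o is Some x then (if x == o0 then h else g) else 1.
have [|pr prP] := @weighting (option Om) wt v.
  have -> : \sum_o wt o = \sum_(o in None |: [set Some x | x in {: Om}]) wt o.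
    by apply: eq_bigl => -[x|]; rewrite !inE // imset_f.
  rewrite big_setU1 /=; last by apply/imsetP => -[].
  rewrite big_imset /=; last by move=> i j _ _ [].
  rewrite (bigD1 o0) //= eqxx.
  rewrite (eq_bigr (fun=> g)); last by move=> x /negbTE->.
  rewrite sum_nat_cond_const.
  have -> : #|[set x : Om | x != o0]| = #|F| ^ D - 1.
    by rewrite cardsE cardC1 card_mx mul1n subn1.
  by rewrite vE mulnC; clear; lia.
have prN : #|fib pr None| = 1 by rewrite prP.
have LD := decomp_alines F D; have [hL1 _ hL3 hL4] := LD.
pose s (l : {set Om}) x y := (l \in alines F D) && cross pr [set Some z | z in l] x y.
have someI : injective (@Some Om) by move=> x y [].
have mS (z : Om) (l : {set Om}) : (Some z \in [set Some z | z in l]) = (z \in l).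
  by rewrite mem_imset.
have F0 : 0 < #|F| := ltnW (finNzRing_gt1 F).
case: (@decomp_fill_infty K _ _ pr prN _ {set Om} s).
- by move=> z; rewrite prP /=; case: ifP.
- move=> l; rewrite /s; case: (boolP (l \in alines F D)) => lL; last exact: dec0.
  apply: (@eq_dec _ _ (cross pr [set Some z | z in l])) => //.
  have cl : #|F| = #|l| by apply: hL1.
  case: (boolP (o0 \in l)) => ol; last first.
    apply: GDD_use dF; first by rewrite card_imset.
    move=> w /imsetP[z zl ->]; rewrite prP /=; case: eqP => // zo.
    by rewrite -zo zl in ol.
  have -> : [set Some z | z in l] = Some o0 |: [set Some z | z in l :\ o0].
    by rewrite -{1}(setD1K ol) imsetU1.
  apply: GDDh_use dh.
  + by rewrite mS !inE eqxx.
  + by rewrite card_imset // cl (cardsD1 o0 l) ol.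
  + by move=> w /imsetP[z + ->]; rewrite !inE prP /= => /andP[/negbTE->].
  + by rewrite prP /= eqxx.
- by move=> l x y /andP[_ /and3P[/imsetP[a _ ->] /imsetP[b _ ->] ->]].
- move=> x y; case Ex: (pr x) => [a|] //; case Ey: (pr y) => [b|] //= ab.
  have ab' : a != b by apply: contraNneq ab => ->.
  have [l lL /andP[al bl]] := hL3 _ _ ab'.
  by exists l; rewrite /s lL /cross Ex Ey !mS al bl.
- move=> l l' x y /andP[lL /and3P[]]; case Ex: (pr x) => [a|]; last by case/imsetP.
  case Ey: (pr y) => [b|]; last by move=> _ /imsetP[].
  rewrite !mS => al bl ab /andP[lL' /and3P[]]; rewrite Ex Ey !mS => al' bl' _.
  by apply: (hL4 _ _ a b) => //; apply: contraNneq ab => ->.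
move=> B BD Bs; exists B; split; first exact: is_PBD_decomp.
move=> Y Yd.
pose Y' := [set z : Om | Some z \in [set pr x | x in Y]].
have cY' : #|Y'| < D.
  apply: leq_ltn_trans dD; apply: leq_trans Yd.
  rewrite -(card_imset _ someI); apply: leq_trans (leq_imset_card pr Y).
  by apply: subset_leq_card; apply/subsetP => o /imsetP[z + ->]; rewrite inE.
have [S [YS S0 [a aS] SL]] := hyperplane cY'.
(* The point at infinity must be included, because it lies on blocks inside the filled groups. *)
pose X := [set x | if pr x is Some z then z \in S else true].
have XE x z : pr x = Some z -> (x \in X) = (z \in S) by rewrite inE => ->.
have sX : is_subspace B X.
  apply/forall_inP => b bB; apply/forall_inP => x xX; apply/forall_inP => y yX.
  apply/implyP => /andP[/andP[xy xb] yb]; apply/subsetP => z zb.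
  case: (eqVneq z x) => [->//|zx].
  case Ez: (pr z) => [c|]; last by rewrite inE Ez.
  rewrite (XE _ _ Ez).
  (* In a filled group, one of the two points is not at infinity and puts the group into [X].
     Otherwise the block lies over a line with two points in [S], hence inside [S]. *)
  have [[t tP]|[l lP]] := Bs _ bB.
    have := tP _ _ zb xb zx; rewrite !inE Ez /= => /eqP[ct].
    have [yx] : y != x by rewrite eq_sym.
    have := tP _ _ yb xb yx; have := tP _ _ xb yb xy; rewrite !inE.
    case/orP=> [/eqP Ex|/eqP Ex]; last by rewrite ct -(XE _ _ Ex).
    case/orP=> [/eqP Ey|/eqP Ey]; last by rewrite ct -(XE _ _ Ey).
    move/eqP/cards1P: prN => [x0 /setP x0P].
    have := x0P x; have := x0P y; rewrite !inE Ex Ey !eqxx => /esym/eqP E1 /esym/eqP E2.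
    by rewrite E1 E2 eqxx in xy.
  have /andP[lL /and3P[xl yl pxy]] := lP _ _ xb yb xy.
  have /andP[_ /and3P[zl _ _]] := lP _ _ zb xb zx.
  move: xl yl zl; rewrite Ez mS => /imsetP[p pl Ep] /imsetP[q ql Eq] cl.
  have pq : p != q by apply: contraNneq pxy => E; rewrite Ep Eq E.
  move: xX yX; rewrite (XE _ _ Ep) (XE _ _ Eq) => pS qS.
  by have /subsetP := SL _ _ _ lL pl ql pq pS qS; apply.
have YX : Y \subset X.
  apply/subsetP => x xY; rewrite inE; case Ex: (pr x) => [z|] //.
  by apply: (subsetP YS); rewrite inE -Ex imset_f.
apply/eqP => gT.
have [x xa] : exists x, x \in fib pr (Some a).
  apply/set0Pn; rewrite -cards_eq0 prP /=; case: (eqVneq a o0) => [a0|_]; last by rewrite -lt0n.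
  by rewrite a0 S0 in aS.
have : x \in gen_subspace B Y by rewrite gT inE.
move/bigcapP/(_ X); rewrite sX YX => /(_ isT).
by move: xa; rewrite inE => /eqP xa; rewrite (XE _ _ xa) (negbTE aS).
Qed.

(** * Sizes and residue classes *)

Lemma pbd_mono (K K' : nat -> Prop) v : (forall n, K n -> K' n) -> pbd K v -> pbd K' v.
Proof.
by move=> KK [B [h1 h2 h3 h4]]; exists B; split=> // b /h1/KK.
Qed.

Lemma eventually_all (Pr : nat -> nat -> Prop) U :
    (forall u, u <= U -> exists x0, forall x, x0 <= x -> Pr u x) ->
  exists x0, forall x, x0 <= x -> forall u, u <= U -> Pr u x.
Proof.
elim: U => [|U IH] H.
  have [x0 h0] := H 0 (leqnn _); exists x0 => x xx u; rewrite leqn0 => /eqP->.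
  exact: h0.
have [|x1 h1] := IH; first by move=> u uU; apply: H; apply: leqW.
have [x2 h2] := H _ (leqnn _).
exists (maxn x1 x2) => x; rewrite geq_max => /andP[xx1 xx2] u.
rewrite leq_eqVlt => /orP[/eqP->|]; first exact: h2.
by rewrite ltnS; apply: h1.
Qed.

Lemma eventually_class (Pr : nat -> Prop) W : 0 < W ->
    (forall c, c < W -> exists x0, forall x, x0 <= x -> x = c %[mod W] -> Pr x) ->
  exists x0, forall x, x0 <= x -> Pr x.
Proof.
move=> W0 H; have [|x0 hx] := @eventually_all (fun c x => x = c %[mod W] -> Pr x) W.-1.
  by move=> c cW; apply: H; rewrite -[W]prednK.
exists x0 => x xx; apply: (hx x xx (x %% W)); last by rewrite modn_mod.
by rewrite -ltnS prednK // ltn_mod.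
Qed.

(** The multiple [y < a * b] of [a] congruent to [x] modulo [b] leaves a nonnegative multiple of
    [b]. *)
Lemma coin_problem a b x : 0 < a -> 0 < b -> coprime a b -> a * b <= x ->
  exists i j, x = i * a + j * b.
Proof.
move=> a0 b0 ab xb; pose y := chinese a b 0 x %% (a * b).
have ya : a %| y.
  by rewrite /dvdn /y modn_dvdm ?dvdn_mulr // chinese_modl // mod0n.
have yb : y = x %[mod b] by rewrite /y modn_dvdm ?dvdn_mull // chinese_modr.
have yx : y <= x by apply: leq_trans xb; apply: ltnW; rewrite ltn_mod muln_gt0 a0.
have /dvdnP[j jE] : b %| x - y by rewrite -eqn_mod_dvd // yb.
have /dvdnP[i iE] := ya.
by exists i, j; rewrite -iE -jE subnKC.
Qed.

(** Adding an element not divisible by the current gcd makes it strictly smaller, so the process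
    stops after finitely many elements. *)
Lemma setgcd_finite (K : nat -> Prop) (f : nat -> nat) g :
    is_setgcd (fun n => exists2 k, K k & n = f k) g -> (exists2 k, K k & 0 < f k) ->
  exists2 l : seq nat, (forall k, k \in l -> K k) &
    forall e, (forall k, k \in l -> e %| f k) -> e %| g.
Proof.
move=> [_ Sg] [k0 Kk0 f0].
suff H n : forall l, 0 < \big[gcdn/0]_(k <- l) f k <= n -> (forall k, k \in l -> K k) ->
    exists2 l' : seq nat, (forall k, k \in l' -> K k) &
    forall e, (forall k, k \in l' -> e %| f k) -> e %| g.
  apply: (H (f k0) [:: k0]); first by rewrite big_seq1 f0 /=.
  by move=> k; rewrite inE => /eqP->.
elim: n => [|n IH] l; first by rewrite leqn0 lt0n; case: eqP.
set d := \big[gcdn/0]_(k <- l) f k => /andP[d0 dn] lK.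
case: (classic (exists2 k, K k & ~~ (d %| f k))) => [[k Kk dk]|ndk].
  apply: (IH (k :: l)); last by move=> t; rewrite inE => /orP[/eqP->|/lK].
  rewrite big_cons gcdn_gt0 d0 orbT /= -ltnS (leq_trans _ dn) // ltn_neqAle.
  rewrite dvdn_leq ?dvdn_gcdr // andbT; apply: contraNneq dk => <-.
  exact: dvdn_gcdl.
exists l => // e el; apply: (@dvdn_trans d); last first.
  by apply: Sg => _ [k Kk ->]; apply/negPn/negP => dk; apply: ndk; exists k.
rewrite /d; elim: l el {d d0 dn lK ndk} => [|t l IHl] el; first by rewrite big_nil dvdn0.
rewrite big_cons dvdn_gcd el ?mem_head //=; apply: IHl => k kl.
by apply: el; rewrite inE kl orbT.
Qed.

Lemma sum_two_weights M a b A B : a + b <= M ->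
  \sum_(i < M) (if i < a then A else if i < a + b then B else 0) = a * A + b * B.
Proof.
move=> abM; rewrite -(subnKC abM); set r := M - _.
rewrite big_split_ord /= [X in _ + X]big1 ?addn0 => [|i _]; last first.
  by rewrite !ltnNge -addnA leq_addr addnA leq_addr.
rewrite big_split_ord /=; congr (_ + _).
  rewrite -[a in RHS]card_ord -sum_nat_const; apply: eq_bigr => i _.
  by rewrite ltn_ord.
rewrite -[b in RHS]card_ord -sum_nat_const; apply: eq_bigr => i _.
by rewrite ltnNge leq_addr /= ltn_add2l ltn_ord.
Qed.

Lemma fact_dvdn m n : m <= n -> m`! %| n`!.
Proof. by move=> mn; rewrite -(bin_fact mn) dvdn_mull // dvdn_mulr. Qed.

(** * Ingredients and assembly of all admissible sizes *)

Section Main.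
Variables (K : nat -> Prop) (ks : seq nat) (al be : nat).
Hypotheses (Kks : forall k, k \in ks -> K k) (ks2 : forall k, k \in ks -> 2 <= k).
Hypothesis ks0 : ks != [::].
Hypothesis alP : forall e, (forall k, k \in ks -> e %| k - 1) -> e %| al.
Hypothesis beP : forall e, (forall k, k \in ks -> e %| k * (k - 1)) -> e %| be.
Hypotheses (al0 : 0 < al) (be0 : 0 < be) (al_be : al %| be).

Definition large (u : nat) := all (fun k => k + 2 <= u) ks.

(** The form [v * v = v] avoids truncated subtraction, so the condition visibly depends only on [v]
    modulo [be]. *)
Definition adm (v : nat) : Prop := v = 1 %[mod al] /\ v * v = v %[mod be].

Lemma largeW u v : u <= v -> large u -> large v.
Proof. by move=> uv /allP H; apply/allP => k /H ku; apply: leq_trans uv. Qed.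

Lemma large_exists : exists u, large u.
Proof.
exists (\sum_(k <- ks) k + 2); apply/allP => k kk; rewrite leq_add2r.
by rewrite (big_rem k) //= leq_addr.
Qed.

Lemma GDD_alpha u : large u -> be %| u * (u - 1) ->
  exists l0, forall p s, prime p -> 0 < s -> l0 <= p ^ s ->
    exists n0, forall n, n0 <= n -> GDD K u (al * (p ^ s) ^ n).
Proof.
move=> /allP ul ub; apply: (@GDD_blowup K u al ks) => //.
- by move=> k kk; split; [apply: ks2 | apply: ul].
- by move=> e /alP; apply: dvdn_mulr.
- move=> e /beP eb; rewrite -mulnA (mulnA al) mulnCA dvdn_mull //.
  exact: dvdn_trans eb ub.
Qed.

Lemma adm_dvd v : 0 < v -> adm v -> al %| v - 1 /\ be %| v * (v - 1).
Proof.
move=> v0 [h1 h2]; split; first by rewrite -eqn_mod_dvd // h1.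
by rewrite mulnBr muln1 -eqn_mod_dvd ?leq_pmull // h2.
Qed.

Lemma dvd_adm v : 0 < v -> al %| v - 1 -> be %| v * (v - 1) -> adm v.
Proof.
move=> v0 h1 h2; split; apply/eqP; first by rewrite eqn_mod_dvd.
by rewrite eqn_mod_dvd ?leq_pmull // -[X in _ - X]muln1 -mulnBr.
Qed.

Lemma adm_mod v w : v = w %[mod be] -> adm w -> adm v.
Proof.
move=> E [h1 h2]; split.
  by rewrite -[v %% al](modn_dvdm _ al_be) E modn_dvdm.
by rewrite -(modnMm v v) E modnMm h2.
Qed.

Lemma GDD_unit u : 0 < u -> large u -> adm u ->
  exists l0, forall p s, prime p -> 0 < s -> l0 <= p ^ s ->
    exists n0, forall n, n0 <= n -> GDD K u ((p ^ s) ^ n).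
Proof.
move=> u0 /allP ul /(adm_dvd u0)[ua ub].
have [||||||l0 H] := @GDD_blowup K u 1 ks => //.
- by move=> k kk; split; [apply: ks2 | apply: ul].
- by move=> e /alP ea; rewrite mul1n; apply: dvdn_trans ua.
- by move=> e /beP eb; rewrite mul1n muln1; apply: dvdn_trans ub.
exists l0 => p s pp s0 ls; have [n0 H'] := H p s pp s0 ls.
by exists n0 => n /H'; rewrite mul1n.
Qed.

(** A large [u] congruent to [c] is blown up by a field of order 1 modulo [W * (k * k.-1)]. The
    product keeps the class of [c], and a cyclotomic design fills the groups. *)
Lemma pbd_residue W c b : 0 < W -> be %| W -> 0 < c -> adm c ->
  exists h, [/\ b <= h, h = c %[mod W] & pbd K h].
Proof.
move=> W0 bW c0 ac.
have [k kk] : exists k, k \in ks by case: (ks) ks0 => // k s _; exists k; rewrite mem_head.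
have k2 := ks2 kk; have [ul ulP] := large_exists.
pose u := c + (ul + b) * W.
have ulu : ul + b <= u by apply: leq_trans (leq_addl _ _); rewrite leq_pmulr.
have u0 : 0 < u by rewrite addn_gt0 c0.
have uc : u = c %[mod W] by rewrite /u addnC modnMDl.
have au : adm u by apply: adm_mod ac; rewrite -(modn_dvdm u bW) uc modn_dvdm.
have [l0 H] := GDD_unit u0 (largeW (leq_trans (leq_addr _ _) ulu) ulP) au.
have [q0 q0P] := pbd_finField k2.
pose m := W * (k * k.-1).
have m0 : 0 < m by rewrite !muln_gt0 W0 (ltnW k2) -ltnS prednK // ltnW.
have [p pm pp] := prime_above m.
have cpm : coprime p m.
  by rewrite prime_coprime // gtnNdvd.
(* The totient makes every power of [p ^ s] equal to 1 modulo [m]; the other factor makes [p ^ s] at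
   least [l0]. *)
pose s := totient m * l0.+1.
have s0 : 0 < s by rewrite muln_gt0 totient_gt0 m0.
have ls : l0 <= p ^ s.
  apply: leq_trans (ltnW (ltn_expl s (prime_gt1 pp))); apply: leq_trans (leqnSn _) _.
  by rewrite leq_pmull // totient_gt0.
have [n0 nP] := H p s pp s0 ls.
pose n := n0 + q0 + 1.
have sn0 : 0 < s * n by rewrite muln_gt0 s0 /n addn1.
have [F _ cF] := PrimePowerField pp sn0.
have Q1 : #|F| = 1 %[mod m].
  rewrite cF /s -mulnA expnM -modnXm (Euler_exp_totient cpm) modnXm exp1n //.
have dF : GDD K u #|F|.
  by rewrite cF expnM; apply: nP; rewrite /n -addnA leq_addr.
have pF : pbd K #|F|.
  apply: (@pbd_mono (eq k)); first by move=> ? <-; apply: Kks.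
  apply: q0P.
    rewrite cF; apply: leq_trans (ltnW (ltn_expl _ (prime_gt1 pp))).
    by apply: leq_trans (leq_pmull _ s0); rewrite /n addnAC leq_addl.
  by rewrite -(modn_dvdm #|F| (dvdn_mull W (dvdnn (k * k.-1)))) Q1 modn_dvdm // dvdn_mull.
exists (u * #|F|); split; last exact: pbd_mul.
  apply: leq_trans (leq_pmulr _ _); first by apply: leq_trans ulu; apply: leq_addl.
  by rewrite cF expn_gt0 prime_gt0.
rewrite -modnMmr -(modn_dvdm #|F| (dvdn_mulr (k * k.-1) (dvdnn W))) Q1.
by rewrite modn_dvdm ?dvdn_mulr // modnMmr muln1.
Qed.

(** One exponent serves all [u <= U], as finitely many thresholds have a maximum; [s] is fixed first
    because the threshold for [n] depends on it. *)
Lemma GDD_alpha_all U p b : prime p -> exists2 t, b <= t &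
  forall u, u <= U -> large u -> be %| u * (u - 1) -> GDD K u (al * p ^ t).
Proof.
move=> pp.
have [s0 s0P] : exists s0, forall s, s0 <= s -> forall u, u <= U ->
    large u && (be %| u * (u - 1)) -> 0 < s ->
    exists n0, forall n, n0 <= n -> GDD K u (al * (p ^ s) ^ n).
  apply: eventually_all => u _; case: (boolP (large u && _)) => [/andP[ul ub]|_].
    have [l0 H] := GDD_alpha ul ub; exists l0 => s ls _ s1; apply: H => //.
    exact: leq_trans ls (ltnW (ltn_expl s (prime_gt1 pp))).
  by exists 0.
have {s0P} s0P := s0P s0.+1 (leqnSn _).
have [n0 n0P] : exists n0, forall n, n0 <= n -> forall u, u <= U ->
    large u && (be %| u * (u - 1)) -> GDD K u (al * (p ^ s0.+1) ^ n).
  apply: eventually_all => u uU; case: (boolP (large u && _)) => ulb; last by exists 0.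
  by have [n0 H] := s0P u uU ulb isT; exists n0 => n /H.
exists (s0.+1 * (n0 + b)); first by apply: leq_trans (leq_addl n0 _) _; rewrite leq_pmull.
move=> u uU ul ub; rewrite expnM; apply: n0P => //; last by rewrite ul.
exact: leq_addr.
Qed.


(** A single [G] has to be the group size of all these designs, while the special group takes either
    of two sizes whose quotients by [al] are coprime. *)
Lemma ingredients (k : nat) : 0 < k -> large k -> be %| k ->
  exists G Q1 Q2, [/\ [/\ 0 < Q1, 0 < Q2 & coprime Q1 Q2], be %| G /\ 0 < G,
    pbd K (G + 1),
    GDD K k G /\ (forall u, k < u -> u = 1 %[mod be] -> GDD K u G) &
    GDDh K k G (al * Q1) /\ GDDh K k G (al * Q2)].
Proof.
move=> k0 kl bk.
set U := k.+1 + k + k * (k.+1`! * be) * (k + k.+1).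
have kU : k.+1 <= U by rewrite /U -addnA leq_addr.
have U0 : 0 < U := leq_trans (ltn0Sn k) kU.
have [t1 t1U d1] := @GDD_alpha_all U 2 U isT.
have [t2 t2U d2] := @GDD_alpha_all U 3 U isT.
set Q1 := 2 ^ t1 in d1 *; set Q2 := 3 ^ t2 in d2 *.
have Q10 : 0 < Q1 by rewrite expn_gt0.
have Q20 : 0 < Q2 by rewrite expn_gt0.
(* The exponents are at least [U] so that [be ^ U], [Q1] and [Q2] all carry transversal designs with
   up to [U] groups. *)
pose g := al * (be ^ U * (Q1 * Q2)).
have g0 : 0 < g by rewrite !muln_gt0 al0 expn_gt0 be0 Q10.
have bg : be %| g by rewrite dvdn_mull // dvdn_mulr // -(prednK U0) expnS dvdn_mulr.
have a1 : adm (1 + g) by apply: (@adm_mod _ 1) => //; have /dvdnP[q ->] := bg; rewrite addnC modnMDl.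
have W0 : 0 < g * U`! by rewrite muln_gt0 g0 fact_gt0.
have [h [hb hE ph]] := @pbd_residue (g * U`!) (1 + g) (g + 2) W0 (dvdn_mulr _ bg) isT a1.
have hg : 1 + g < h by rewrite addnC -addn1 -addnA.
have /dvdnP[x xE] : g * U`! %| h - (1 + g) by rewrite -eqn_mod_dvd ?hE // ltnW.
have x0 : 0 < x by rewrite lt0n; apply: contraTneq hg => x0; rewrite -leqNgt -subn_eq0 xE x0.
(* [h] was taken congruent to [1 + g] modulo [g] times the factorial, so [(h - 1) / g] is 1 modulo
   that factorial and [TD_Zp] applies to it. *)
pose N := x * U`! + 1.
have hN : h = g * N + 1.
  rewrite -(subnK (ltnW hg)) xE /N mulnDr muln1 mulnCA mulnA (mulnC g) -mulnA (mulnC g).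
  by rewrite mulnA; clear; lia.
have N1 : 1 < N by rewrite /N addn1 ltnS muln_gt0 x0 fact_gt0.
have tdN u : u.+1 <= U -> TD u.+1 N.
  move=> uU; apply: TD_Zp => //; apply: coprime_dvdr (fact_dvdn uU) _.
  by rewrite coprime_sym /coprime /N gcdnMDl gcdn1.
have td1 u : u.+1 <= U -> TD u.+1 (be ^ U * Q2 * N).
  move=> uU; apply: TD_mul; last exact: tdN.
  by apply: TD_mul; apply: TD_exp => //; apply: leq_trans t2U.
have td2 u : u.+1 <= U -> TD u.+1 (be ^ U * Q1 * N).
  move=> uU; apply: TD_mul; last exact: tdN.
  by apply: TD_mul; apply: TD_exp => //; apply: leq_trans t1U.
(* [G] is read in two ways as a transversal design size times a known group size; truncating a last
   group to one point leaves [al * Q1] or [al * Q2]. *)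
have GE1 : g * N = be ^ U * Q2 * N * (al * Q1) by rewrite /g; clear; lia.
have GE2 : g * N = be ^ U * Q1 * N * (al * Q2) by rewrite /g; clear; lia.
have ul u : k <= u -> large u by move=> ku; apply: largeW ku kl.
have bk' : be %| k * (k - 1) by rewrite dvdn_mulr.
have bu u : k < u -> u = 1 %[mod be] -> be %| u * (u - 1).
  by move=> ku u1; rewrite dvdn_mull // -eqn_mod_dvd ?u1 //; apply: leq_trans ku.
have k1 : k.+1 = 1 %[mod be] by have /dvdnP[q ->] := bk; rewrite -addn1 modnMDl.
have kk1 := ltnSn k.
have dk : GDD K k (g * N).
  have [k' kE] : exists k', k = k'.+1 by exists k.-1; rewrite prednK.
  rewrite GE1 kE; apply: GDD_inflate; first by apply: td1; rewrite -kE ltnW.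
  by rewrite -kE; apply: d1 => //; exact: ltnW.
exists (g * N), Q1, Q2; split.
- by rewrite Q10 Q20; split=> //; rewrite coprimeXl // coprimeXr.
- by split; [rewrite dvdn_mulr | rewrite muln_gt0 g0 ltnW].
- by rewrite -hN.
- split=> //; apply: GDD_all => // u /andP[ku uU] u1.
  have [u' uE] : exists u', u = u'.+1 by exists u.-1; rewrite prednK // (leq_trans _ ku).
  rewrite GE1 uE; apply: GDD_inflate; first by apply: td1; rewrite -uE.
  by rewrite -uE; apply: d1 => //; [apply: ul; apply: ltnW | apply: bu].
- split.
    rewrite GE1 -[X in GDDh _ _ _ X]mul1n; apply: GDDh_truncate.
    + exact: td1.
    + by apply: d1 => //; apply: ltnW.
    + by apply: d1 => //; [apply: ul | apply: bu].
    + by rewrite !muln_gt0 expn_gt0 be0 Q20 ltnW.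
  rewrite GE2 -[X in GDDh _ _ _ X]mul1n; apply: GDDh_truncate.
  + exact: td2.
  + by apply: d2 => //; apply: ltnW.
  + by apply: d2 => //; [apply: ul | apply: bu].
  + by rewrite !muln_gt0 expn_gt0 be0 Q10 ltnW.
Qed.

Lemma pbd_dim_exists d : exists v0, forall v, v0 <= v -> adm v ->
  exists B : {set {set 'I_v}}, is_PBD K B /\ dim_at_least B d.
Proof.
have [ul ulP] := large_exists.
have [p pb pp] := prime_above (be + ul).
have tb : 0 < totient be by rewrite totient_gt0.
have [F _ cF] := PrimePowerField pp tb.
have pF : p <= #|F| by rewrite cF -{1}[p]expn1 leq_exp2l // prime_gt1.
have F1 : #|F| = 1 %[mod be].
  rewrite cF Euler_exp_totient // prime_coprime // gtnNdvd //.
  exact: leq_ltn_trans (leq_addr _ _) pb.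
pose k := #|F|.-1.
have F0 : 0 < #|F| by rewrite (leq_trans (prime_gt0 pp)).
have Fk : #|F| = k.+1 by rewrite prednK.
have kb : be + ul <= k by rewrite -ltnS -Fk (leq_trans pb).
have k0 : 0 < k by rewrite (leq_trans be0) // (leq_trans (leq_addr _ _) kb).
have kl : large k by apply: largeW ulP; apply: leq_trans kb; apply: leq_addl.
have bk : be %| k by have : be %| #|F| - 1 by [rewrite -eqn_mod_dvd ?F1|]; rewrite Fk subn1.
have [G [Q1 [Q2 [[Q10 Q20 cQ] [bG G0] pG [dk dall] [dh1 dh2]]]]] := ingredients k0 kl bk.
(* With [M = Z * j + 1], the ordinary points weigh [M * X = X + j * W] in total, so
   [v = hh + X + j * W]. The factor [Z] makes [M] suitable for [TD_Zp] and 1 modulo [be]. *)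
pose n := #|F| ^ d.+1; pose Z := k.+1`! * be; pose X := G * (n - 1); pose W := X * Z.
have n1 : 0 < n - 1.
  by rewrite subn_gt0 /n -[X in X < _](exp1n d.+1) ltn_exp2r // Fk.
have Z0 : 0 < Z by rewrite muln_gt0 fact_gt0.
have X0 : 0 < X by rewrite muln_gt0 G0.
have W0 : 0 < W by rewrite muln_gt0 X0.
have bX : be %| X by rewrite dvdn_mulr.
have bW : be %| W by rewrite dvdn_mulr.
have XW : X <= W by rewrite leq_pmulr.
apply: (eventually_class W0) => c cW.
(* [c - X] modulo [W], the class required of [hh], made positive by adding [2 * W]. It agrees with
   [c] modulo [be], since [be] divides [X]. *)
pose c' := c + (W + (W - X)).
have c'c : c' = c %[mod be].
  have /dvdnP[q qE] : be %| W + (W - X) by rewrite dvdn_add // dvdn_sub.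
  by rewrite /c' qE addnC modnMDl.
have c'X : c' + X = c + 2 * W by rewrite /c' -addnA -addnA subnK // addnn mul2n.
have c'0 : 0 < c' by rewrite /c' addn_gt0 addn_gt0 W0 orbT.
case: (classic (adm c')) => [ac|nac]; last first.
  exists 0 => v _ vc av; case: nac; apply: adm_mod av.
  by rewrite c'c -(modn_dvdm c bW) -vc modn_dvdm.
have [hh [hb hE ph]] := pbd_residue (al * (Q1 * Q2) + 1) W0 bW c'0 ac.
have hh0 : 0 < hh by rewrite (leq_trans _ hb) // addn1.
have ahh : adm hh by apply: adm_mod ac; rewrite -(modn_dvdm hh bW) hE modn_dvdm.
(* This forces [j >= hh + k + 2], hence [M] exceeds [k] and the number [a + b] of weighted
   points. *)
exists (hh + X + (hh + k + 2) * W) => v vb vc _.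
have hXv : hh + X <= v by apply: leq_trans vb; apply: leq_addr.
have /dvdnP[j jE] : W %| v - (hh + X).
  rewrite -eqn_mod_dvd // vc -[in X in _ == X]modnDml hE modnDml c'X.
  by rewrite addnC modnMDl.
have jl : hh + k + 2 <= j.
  by rewrite -(leq_pmul2r W0) -jE leq_subRL.
pose M := Z * j + 1.
have vE : v = M * G * (n - 1) + (hh - 1) + 1.
  rewrite -addnA subnK // -(subnK hXv) jE /M /W /X; clear; lia.
have jM : j < M by rewrite /M addn1 ltnS leq_pmull.
have M1 : M = 1 %[mod be] by rewrite /M /Z mulnAC modnMDl.
have kM : k < M by apply: leq_trans jM; rewrite ltnS; clear -jl; lia.
have tdM : TD k.+1 M.
  apply: TD_Zp; first exact: leq_ltn_trans kM.
  by rewrite coprime_sym /coprime /M /Z -mulnA mulnC gcdnMDl gcdn1.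
have k1 : k.+1 = 1 %[mod be] by have /dvdnP[q ->] := bk; rewrite -addn1 modnMDl.
have [/dvdnP[y yE] _] := adm_dvd hh0 ahh.
have yQ : Q1 * Q2 <= y.
  by rewrite -(leq_pmul2l al0) (mulnC al y) -yE leq_subRL // addnC.
have [a [b abE]] := coin_problem Q10 Q20 cQ yQ.
have abM : a + b <= M.
  apply: leq_trans (_ : y <= _).
    by rewrite abE leq_add // leq_pmulr.
  apply: leq_trans (leq_pmulr y al0) _; rewrite -yE.
  apply: leq_trans (leq_subr _ _) _; apply: ltnW; apply: leq_ltn_trans jM.
  by apply: leq_trans jl; rewrite -addnA leq_addr.
apply: (@pbd_dimension K F d.+1 d (M * G) (hh - 1) v) => //.
- by rewrite muln_gt0 G0 (leq_ltn_trans _ kM).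
- by rewrite Fk; apply: GDD_inflate => //; apply: dall.
(* In the last group, [a] points get weight [al * Q1], [b] points get [al * Q2] and the rest get
   0. *)
- rewrite -/k yE abE.
  have -> : (a * Q1 + b * Q2) * al = a * (al * Q1) + b * (al * Q2) by clear; lia.
  rewrite -(sum_two_weights _ _ abM); apply: GDDh_wilson => // i.
  by case: ifP => _ //; case: ifP => _ //; apply: GDDh0.
- by apply: pbd_fill_infty pG; apply: dall.
- by rewrite subnK.
Qed.
End Main.

Theorem theorem1 (K : nat -> Prop) (HK : forall k, K k -> 2 <= k)
  (d : nat) (hd : 0 < d) (alpha beta : nat)
  (Halpha : is_alpha K alpha) (Hbeta : is_beta K beta) :
  exists v0 : nat, forall v : nat, v0 <= v ->
    v - 1 = 0 %[mod alpha] -> v * (v - 1) = 0 %[mod beta] ->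
    exists B : {set {set 'I_v}}, is_PBD K B /\ dim_at_least B d.
Proof.
case: (classic (exists k, K k)) => [[k0 Kk0]|nK]; last first.
  (* For empty [K] the gcd is 0, and [v - 1 = 0] contradicts [2 <= v]. *)
  exists 2 => v v2; have a0 : alpha = 0.
    apply/eqP; rewrite -dvd0n; case: Halpha => _; apply=> s [k Kk _].
    by case: nK; exists k.
  rewrite a0 !modn0 => /eqP; rewrite subn_eq0 leqNgt v2 //.
have k02 := HK _ Kk0.
have [|la laK laP] := setgcd_finite Halpha.
  by exists k0; rewrite // subn_gt0.
have [|lb lbK lbP] := setgcd_finite Hbeta.
  by exists k0; rewrite // muln_gt0 subn_gt0 k02 ltnW.
have Ka k : K k -> alpha %| k - 1 by move=> Kk; case: Halpha => H _; apply: H; exists k.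
have Kb k : K k -> beta %| k * (k - 1) by move=> Kk; case: Hbeta => H _; apply: H; exists k.
have a0 : 0 < alpha by apply: dvdn_gt0 (Ka _ Kk0); rewrite subn_gt0.
have b0 : 0 < beta by apply: dvdn_gt0 (Kb _ Kk0); rewrite muln_gt0 subn_gt0 k02 ltnW.
have ab : alpha %| beta.
  by case: Hbeta => _; apply=> _ [k Kk ->]; rewrite dvdn_mull // Ka.
(* [la] captures the gcd [alpha] and [lb] the gcd [beta]; [k0] keeps the list nonempty. *)
pose ks := k0 :: la ++ lb.
have ksK k : k \in ks -> K k.
  by rewrite inE mem_cat => /orP[/eqP->|/orP[/laK|/lbK]].
have [||||v0 v0P] := @pbd_dim_exists K ks alpha beta ksK _ _ _ _ a0 b0 ab d => //.
- by move=> k /ksK/HK.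
- by move=> e He; apply: laP => k kl; apply: He; rewrite inE mem_cat kl orbT.
- by move=> e He; apply: lbP => k kl; apply: He; rewrite inE mem_cat kl !orbT.
exists v0.+1 => v vv va vb; apply: v0P; first exact: ltnW.
have v1 : 0 < v by apply: leq_trans vv.
by apply: dvd_adm => //; rewrite /dvdn ?va ?vb mod0n.
Qed.
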